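(* Let $n\ge2$, $\lambda_1,\dots,\lambda_n>1$, and let $X_j$ be an $\mathcal{L}_{\infty,\lambda_j}$ space for $j=1,\dots,n$. Then every continuous $n$-linear mapping $T:X_1\times\dots\times X_n\to\mathbb{K}$ is $(2;2,\dots,2,\infty)$-summing at the origin, and, for all $n\ge3$, $$\|T\|_{as(2;2,\dots,2,\infty)}\le C_2(X_n')\,K_G\,3^{\frac{n-3}{2}}\,\|T\|\prod_{j=1}^n\lambda_j .$$
   Context: All spaces are Banach spaces over $\mathbb{K}=\mathbb{R}$ or $\mathbb{C}$; $X'$ is the topological dual of $X$. $K_G$ is Grothendieck's constant. A Banach space $X$ is an $\mathcal{L}_{\infty,\lambda}$ space ($\lambda>1$) if every finite dimensional subspace $G$ of $X$ is contained in a finite dimensional subspace $H$ of $X$ for which there is an isomorphism $v:H\to l_\infty^{\dim H}$ with $\|v\|\|v^{-1}\|<\lambda$. A Banach space $F$ has cotype $2$ if there is a constant $C_2(F)\ge0$ such that $(\sum_{j=1}^k\|x_j\|^2)^{1/2}\le C_2(F)\big(\int_0^1\|\sum_{j=1}^k r_j(t)x_j\|^2dt\big)^{1/2}$ for all $k$ and $x_1,\dots,x_k\in F$ ($r_j$ the Rademacher functions); $C_2(F)$ denotes such a constant. (Duals of $\mathcal{L}_\infty$ spaces have cotype 2.) For $0<p<\infty$, $l_p^w(E)$ is the space of sequences $(x_j)$ in $E$ with $\|(x_j)\|_{w,p}=\sup_{\varphi\in B_{E'}}(\sum_j|\varphi(x_j)|^p)^{1/p}<\infty$; $l_\infty^w(E)=l_\infty(E)$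 is the space of bounded sequences with $\|(x_j)\|_{w,\infty}=\sup_j\|x_j\|$; $l_p(E)$ is the space of sequences with $\sum_j\|x_j\|^p<\infty$. A continuous $n$-linear $T:E_1\times\dots\times E_n\to F$ is $(p;q_1,\dots,q_n)$-summing at the origin if $(T(x_j^{(1)},\dots,x_j^{(n)}))_j\in l_p(F)$ whenever $(x_j^{(s)})_j\in l_{q_s}^w(E_s)$, $s=1,\dots,n$; then $\|T\|_{as(p;q_1,\dots,q_n)}$ is the infimum of the $L>0$ with $(\sum_j\|T(x_j^{(1)},\dots,x_j^{(n)})\|^p)^{1/p}\le L\prod_s\|(x_j^{(s)})_j\|_{w,q_s}$ for all such sequences. In $(2;2,\dots,2,\infty)$ the first $n-1$ indices $q_s$ equal $2$ and $q_n=\infty$. *)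

(* Defs.v *)
From HB Require Import structures.
From mathcomp Require Import all_boot all_order all_algebra.
From mathcomp Require Import complex.
From mathcomp Require Import all_classical all_reals all_analysis.

Set Implicit Arguments.
Unset Strict Implicit.
Unset Printing Implicit Defensive.

Import Order.TTheory GRing.Theory Num.Theory.
Import numFieldNormedType.Exports.

Local Open Scope classical_set_scope.
Local Open Scope ring_scope.

Variant scalars := RealScalars | ComplexScalars.

Definition base (R : realType) (k : scalars) : numFieldType :=
  match k with RealScalars => R | ComplexScalars => R[i]%C end.

Definition real_part (R : realType) (k : scalars) : base R k -> R :=
  match k with
  | RealScalars => fun x : R => x
  | ComplexScalars => fun z : R[i]%C => complex.Re z
  end.

Definition of_real (R : realType) (k : scalars) : R -> base R k :=
  match k with
  | RealScalars => fun x : R => x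
  | ComplexScalars => fun x : R => (x%:C)%C
  end.
Arguments of_real {R} k x.

Definition conj_base (R : realType) (k : scalars) : base R k -> base R k :=
  match k with
  | RealScalars => fun x : R => x
  | ComplexScalars => fun z : R[i]%C => conjc z
  end.

(* The norm of a normed module over [base R k] takes its values in the
   nonnegative elements of [base R k]; [rnorm] is that norm read in [R]. *)
Definition rnorm (R : realType) (k : scalars) (V : normedZmodType (base R k))
  (x : V) : R := real_part `|x|.

Section base_lemmas.
Variables (R : realType) (k : scalars).
Implicit Types (x y : R) (a : base R k).

Lemma of_realD x y : of_real k (x + y) = of_real k x + of_real k y.
Proof. by case: k => //=; rewrite rmorphD. Qed.

Lemma of_realM x y : of_real k (x * y) = of_real k x * of_real k y.
Proof. by case: k => //=; rewrite rmorphM. Qed.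

Lemma of_real0 : of_real k 0 = 0 :> base R k.
Proof. by case: k. Qed.

Lemma ler_of_real x y : (of_real k x <= of_real k y) = (x <= y).
Proof. by case: k => //=; rewrite lecR. Qed.

Lemma of_realK x : real_part (of_real k x) = x.
Proof. by case: k. Qed.

Lemma real_partK a : 0 <= a -> of_real k (real_part a) = a.
Proof.
case: k a => //= -[u v]; rewrite lecE /= => /andP[/eqP -> _] //.
Qed.

Lemma of_real_rnorm (V : normedZmodType (base R k)) (v : V) :
  of_real k (rnorm v) = `|v|.
Proof. exact: real_partK. Qed.

Lemma rnorm_ge0 (V : normedZmodType (base R k)) (v : V) : 0 <= rnorm v.
Proof. by rewrite -ler_of_real of_real0 of_real_rnorm. Qed.

Lemma rnorm0 (V : normedZmodType (base R k)) : rnorm (0 : V) = 0.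
Proof. by rewrite /rnorm normr0 -of_real0 of_realK. Qed.

End base_lemmas.


Section operator_norm.
Variables (R : realType) (k : scalars) (V W : normedModType (base R k)).

(* [sup] returns 0 on a set that is not bounded above, so these are operator
   norms only for continuous linear maps, as is [mnorm] below for continuous
   multilinear ones. *)
Definition opnorm_on (H : set V) (f : V -> W) : R :=
  sup [set rnorm (f x) | x in [set x | H x /\ rnorm x <= 1]].

Definition opnorm (f : V -> W) : R := opnorm_on setT f.

End operator_norm.

Section dual.
Variables (R : realType) (k : scalars) (V : normedModType (base R k)).
Local Notation K := (base R k).

Definition dual_set : set (V -> K) := [set f : V -> K | scalar f /\ continuous f].
Definition dual_pred : {pred V -> K} := mem dual_set.

Lemma dual_submod_closed : submod_closed dual_pred.
Proof.
split=> [|a f g /set_mem[lf cf] /set_mem[lg cg]]; apply/mem_set; split.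
- by move=> c u v /=; rewrite /GRing.zero /= mulr0 addr0.
- exact: cst_continuous.
- move=> c u v.
  change (a * f (c *: u + v) + g (c *: u + v) =
    c * (a * f u + g u) + (a * f v + g v)).
  by rewrite lf lg !mulrDr !mulrA [a * c]mulrC addrACA.
- move=> x; apply: continuousD; last exact: cg.
  by apply: (@continuousZr _ K^o); exact: cf.
Qed.

HB.instance Definition _ :=
  GRing.isSubmodClosed.Build K (V -> K) dual_pred dual_submod_closed.

Record dual := Dual { dual_fun :> V -> K; _ : dual_fun \in dual_pred }.

HB.instance Definition _ := [isSub for dual_fun].
HB.instance Definition _ := [Choice of dual by <:].
HB.instance Definition _ := [SubChoice_isSubLmodule of dual by <:].

Lemma dual_linear (f : dual) : scalar f.
Proof. by case: f => f /= /set_mem[]. Qed.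

Lemma dual_continuous (f : dual) : continuous f.
Proof. by case: f => f /= /set_mem[]. Qed.

Lemma dual_bounded (f : dual) :
  has_ubound [set rnorm (f x) | x in [set x | setT x /\ rnorm x <= 1]].
Proof.
pose g : {linear V -> K^o} :=
  HB.pack (f : V -> K^o) (GRing.isLinear.Build _ _ _ _ (f : V -> K^o)
    (dual_linear f)).
have : bounded_near g (nbhs (0 : V)).
  by apply: continuous_linear_bounded; exact: dual_continuous.
move=> /linear_boundedP/pinfty_ex_gt0[M M0 fM].
exists (real_part M) => _ [x [_ x1] <-].
rewrite -(ler_of_real k) of_real_rnorm (real_partK (ltW M0)).
apply: (le_trans (fM x)); rewrite ler_piMr ?(ltW M0)//.
rewrite -of_real_rnorm; apply: (@le_trans _ _ (of_real k 1)).
  by rewrite ler_of_real.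
by case: (k).
Qed.

Lemma dual_opnorm_ge (f : dual) (x : V) :
  rnorm x <= 1 -> rnorm (f x) <= opnorm f.
Proof. by move=> x1; apply: (ub_le_sup (dual_bounded f)); exists x. Qed.

Lemma dual_opnorm_le (f : dual) (c : R) :
  (forall x, rnorm x <= 1 -> rnorm (f x) <= c) -> opnorm f <= c.
Proof.
move=> fc; apply: ge_sup; last by move=> _ [x [_ x1] <-]; exact: fc.
by exists (rnorm (f 0)), 0 => //; split=> //; rewrite rnorm0.
Qed.

Definition dual_norm (f : dual) : K := of_real k (opnorm f).

Lemma dual_normD (f g : dual) : dual_norm (f + g) <= dual_norm f + dual_norm g.
Proof.
rewrite /dual_norm -of_realD ler_of_real; apply: dual_opnorm_le => x x1.
apply: (@le_trans _ _ (rnorm (f x) + rnorm (g x))).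
  rewrite -(ler_of_real k) of_realD !of_real_rnorm.
  exact: (ler_normD (f x) (g x)).
by rewrite lerD// dual_opnorm_ge.
Qed.

Let dual_normZ_le (a : K) (f : dual) : dual_norm (a *: f) <= `|a| * dual_norm f.
Proof.
rewrite /dual_norm -[`|a|]of_real_rnorm -of_realM ler_of_real.
apply: dual_opnorm_le => x x1.
have -> : rnorm ((a *: f) x) = rnorm a * rnorm (f x).
  apply/eqP; rewrite eq_le -!(ler_of_real k) of_realM !of_real_rnorm.
  by rewrite (_ : (a *: f) x = a * f x)// normrM lexx.
by rewrite ler_wpM2l ?rnorm_ge0 ?dual_opnorm_ge.
Qed.

Lemma dual_normZ (a : K) (f : dual) : dual_norm (a *: f) = `|a| * dual_norm f.
Proof.
apply/eqP; rewrite eq_le dual_normZ_le /=.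
have [->|a0] := eqVneq a 0.
  rewrite normr0 mul0r -(of_real0 R k) ler_of_real.
  have x1 : rnorm (0 : V) <= 1 by rewrite rnorm0.
  exact: le_trans (rnorm_ge0 _) (dual_opnorm_ge _ x1).
rewrite -ler_pdivlMl ?normr_gt0// -normfV.
by rewrite -{1}(scale1r f) -(mulVf a0) -scalerA; exact: dual_normZ_le.
Qed.

Lemma dual_norm0_eq0 (f : dual) : dual_norm f = 0 -> f = 0.
Proof.
move=> f0; have {}f0 : opnorm f <= 0.
  by rewrite -(ler_of_real k) -/(dual_norm f) f0 of_real0.
have fx0 (x : V) : rnorm x <= 1 -> f x = 0.
  move=> x1; apply/normr0_eq0/eqP; rewrite -of_real_rnorm eq_le.
  rewrite -(of_real0 R k) !ler_of_real rnorm_ge0 andbT.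
  exact: le_trans (dual_opnorm_ge _ x1) f0.
apply/val_inj/funext => x /=.
have fZ a (u : V) : f (a *: u) = a * f u.
  have f00 : f 0 = 0 by apply: fx0; rewrite rnorm0.
  by have := dual_linear f a u 0; rewrite addr0 f00 addr0.
have [->|x0] := eqVneq x 0; first by rewrite -[0 in LHS](scale0r 0) fZ mul0r.
have nx0 : `|x| != 0 by rewrite normr_eq0.
rewrite -[x](scalerKV nx0) fZ fx0 ?mulr0//.
rewrite -(ler_of_real k) of_real_rnorm normrZ normfV normr_id mulVf//.
by case: (k).
Qed.

HB.instance Definition _ := Lmodule_isNormed.Build K dual
  dual_normD dual_normZ dual_norm0_eq0.

Lemma rnorm_dual (f : dual) : rnorm f = opnorm f.
Proof. exact: of_realK. Qed.

End dual.

Section spaces.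
Variables (R : realType) (k : scalars).
Local Notation K := (base R k).

Definition has_dim (V : lmodType K) (H : set V) (d : nat) : Prop :=
  exists e : 'I_d -> V,
    (forall c : 'I_d -> K, \sum_i c i *: e i = 0 -> forall i, c i = 0) /\
    H = range (fun c : 'I_d -> K => \sum_i c i *: e i).

(* The norm of ['rV[K]_d] is the maximum norm, so this space is l_infty^d.
   Only the values of [v] on [H] matter, and [w] is its inverse. *)
Definition Linfty_space (lambda : R) (X : normedModType K) : Prop :=
  forall (G : set X) (d : nat), has_dim G d ->
  exists (H : set X) (m : nat), [/\ has_dim H m, G `<=` H &
    exists (v : X -> 'rV[K]_m) (w : 'rV[K]_m -> X),
    [/\ (forall (a : K) (x y : X), H x -> H y ->
           v (a *: x + y) = a *: v x + v y),
        {within H, continuous v} /\ continuous w,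
        (forall x, H x -> w (v x) = x),
        (forall y, H (w y) /\ v (w y) = y) &
        opnorm_on H v * opnorm w < lambda]].

(* The Rademacher function usually written r_(j+1). *)
Definition rademacher (j : nat) (t : R) : R := Num.sg (sin (2 ^+ j.+1 * pi * t)).

Definition cotype2_constant (F : normedModType K) (C : R) : Prop :=
  0 <= C /\
  forall (m : nat) (x : 'I_m -> F),
    Num.sqrt (\sum_(j < m) rnorm (x j) ^+ 2) <=
    C * Num.sqrt (\int[lebesgue_measure]_(t in `[0, 1])
      (rnorm (\sum_(j < m) of_real k (rademacher j t) *: x j) ^+ 2)).

(* [weak_norm q x] is the norm of [x] in l_q^w(E), equal to +oo when [x] is not
   in that space; only exponents [0 < q <= +oo] are meaningful. *)
Definition weak_norm (E : normedModType K) (q : \bar R) (x : nat -> E) : \bar R :=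
  match q with
  | r%:E => ereal_sup
      [set ((\sum_(0 <= j <oo) (rnorm (phi (x j)) `^ r)%:E) `^ r^-1)%E
        | phi in [set phi : dual E | rnorm phi <= 1]]
  | _ => ereal_sup (range (fun j => (rnorm (x j))%:E))
  end.

(* The p-th power of the norm in l_p(F), equal to +oo outside l_p(F). *)
Definition psum (F : normedModType K) (p : R) (y : nat -> F) : \bar R :=
  (\sum_(0 <= j <oo) (rnorm (y j) `^ p)%:E)%E.

(* Grothendieck's inequality for vectors of l_2^d, with [d] arbitrary; finitely
   many vectors of a Hilbert space always span a copy of some l_2^d. *)
Definition grothendieck_bound (C : R) : Prop :=
  forall (m n d : nat) (a : 'M[K]_(m, n)) (x : 'I_m -> 'rV[K]_d)
    (y : 'I_n -> 'rV[K]_d),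
    (forall (s : 'I_m -> K) (t : 'I_n -> K),
      (forall i, rnorm (s i) <= 1) -> (forall j, rnorm (t j) <= 1) ->
      rnorm (\sum_(i < m) \sum_(j < n) a i j * s i * t j) <= 1) ->
    (forall i, Num.sqrt (\sum_(l < d) rnorm (x i 0 l) ^+ 2) <= 1) ->
    (forall j, Num.sqrt (\sum_(l < d) rnorm (y j 0 l) ^+ 2) <= 1) ->
    rnorm (\sum_(i < m) \sum_(j < n)
      a i j * (\sum_(l < d) x i 0 l * conj_base (y j 0 l))) <= C.

End spaces.

Definition grothendieck_constant (R : realType) (k : scalars) : R :=
  inf [set C : R | @grothendieck_bound R k C].

Section multilinear.
Variables (R : realType) (k : scalars) (n : nat).
Local Notation K := (base R k).
Variables (E : 'I_n -> completeNormedModType K) (F : normedModType K).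

Definition multilinear (T : (forall i, E i) -> F) : Prop :=
  forall (x : forall i, E i) (i : 'I_n) (a : K) (u v : E i),
    T (dfwith x i (a *: u + v)) = a *: T (dfwith x i u) + T (dfwith x i v).

Definition continuous_multilinear (T : (forall i, E i) -> F) : Prop :=
  multilinear T /\ continuous (T : prod_topology (fun i => E i) -> F).

Definition mnorm (T : (forall i, E i) -> F) : R :=
  sup [set rnorm (T x) | x in [set x | forall i, rnorm (x i) <= 1]].

Definition summing_at_origin (p : R) (q : 'I_n -> \bar R)
  (T : (forall i, E i) -> F) : Prop :=
  forall x : (forall i, nat -> E i),
    (forall i, (weak_norm (q i) (x i) < +oo)%E) ->
    (psum p (fun j => T (fun i => x i j)) < +oo)%E.

Definition as_norm (p : R) (q : 'I_n -> \bar R) (T : (forall i, E i) -> F) :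
  \bar R :=
  ereal_inf [set L%:E | L in [set L : R | 0 < L /\
    forall x : (forall i, nat -> E i),
      (forall i, (weak_norm (q i) (x i) < +oo)%E) ->
      (psum p (fun j => T (fun i => x i j)) `^ p^-1 <=
       (L * \prod_(i < n) fine (weak_norm (q i) (x i)))%:E)%E]].

End multilinear.

Lemma last_index_proof (n : nat) : (2 <= n)%N -> (n.-1 < n)%N.
Proof. by case: n. Qed.

Definition last_index (n : nat) (n_ge2 : (2 <= n)%N) : 'I_n :=
  Ordinal (last_index_proof n_ge2).

Definition exponents (R : realType) (n : nat) (n_ge2 : (2 <= n)%N) (i : 'I_n) :
  \bar R := if i == last_index n_ge2 then +oo%E else 2%:E.

(* Main.v *)
Require Import Defs.
From HB Require Import structures.
From mathcomp Require Import all_boot all_order all_algebra.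
From mathcomp Require Import complex ring lra.
From mathcomp Require Import all_classical all_reals all_analysis.

Set Implicit Arguments.
Unset Strict Implicit.
Unset Printing Implicit Defensive.

Import Order.TTheory GRing.Theory Num.Theory.
Import numFieldNormedType.Exports.

Local Open Scope classical_set_scope.
Local Open Scope ring_scope.

(** A finite family (x_j) in an L_(oo,lambda) space with weak 2-norm w can be
    written in coordinates of an l_oo^m in such a way that each coordinate, as
    a function of j, is a vector of l_2 of norm at most lambda * w
    ([Linfty_coordinates], which extends the coordinate functionals to the
    whole space by the Hahn-Banach theorem).

    The heart of the proof is then [multilinear_sum_bound]: if the first p >= 2
    variables run through such families and the other variables are frozen in
    the unit balls, then
      sum_j |T(x_j)| <= K_G 3^((p - 2)/2) |T| prod_(i < p) (lambda_i w_i).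
    For p = 2 this is Grothendieck's inequality ([bilinear_sum_bound]).  A
    further variable costs a factor sqrt 3 ([coordinate_step]): expand it in
    its coordinates, apply the Cauchy-Schwarz inequality in j, and bound the
    resulting l_2 norms by averages over signs with Khintchine's inequality.
    Inside an average the signs can be absorbed: the sum of the moduli over the
    coordinates is the value of a sum over j at one frozen vector of the unit
    ball, to which the bound for the other variables applies.

    Both assertions follow.  For summability, multiply the last variable of the
    j-th term by beta_j = |T(x_j)|: a bounded sequence times a vector of l_2 is
    weakly 2-summable, so p = n gives sum_j beta_j ^ 2 <= C |beta|_2, that is
    |beta|_2 <= C ([sum_sqr_bound]).  For the estimate, the bound with p = n - 1
    says that every signed sum of the functionals T(x_j^1, .., x_j^(n-1), -) is
    bounded in the dual of X_n, and cotype 2 turns this into a bound for the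
    square sum of their norms ([cotype_slices]).

    Since K_G is an infimum, it is a bound in Grothendieck's inequality only
    because some bound exists; [grothendieck_inequality] gives the bound 6 by a
    truncation argument, over the reals and over the complex numbers alike. *)

(** * Moduli, real parts and conjugates *)

Section scalar_field.
Variables (R : realType) (k : scalars).
Local Notation K := (base R k).
Implicit Types (a b : K) (r s : R).

Lemma of_real1 : of_real k 1 = 1 :> K.
Proof. by case: k. Qed.

Lemma of_realN r : of_real k (- r) = - of_real k r.
Proof. by case: k => //=; rewrite rmorphN. Qed.

Lemma of_real_sum (I : Type) (r : seq I) (P : pred I) (F : I -> R) :
  of_real k (\sum_(i <- r | P i) F i) = \sum_(i <- r | P i) of_real k (F i).
Proof. exact: (big_morph _ (@of_realD _ _) (@of_real0 _ _)). Qed.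

Lemma ltr_of_real (r s : R) : (of_real k r < of_real k s) = (r < s).
Proof. by case: k => //=; rewrite ltcR. Qed.

Lemma real_partD a b : real_part (a + b) = real_part a + real_part b.
Proof. by case: k a b => //= -[? ?] [? ?]. Qed.

Lemma real_partN a : real_part (- a) = - real_part a.
Proof. by case: k a => //= -[? ?]. Qed.

Lemma real_part0 : real_part (0 : K) = 0.
Proof. by case: k. Qed.

Lemma real_part_sum (I : Type) (r : seq I) (P : pred I) (F : I -> K) :
  real_part (\sum_(i <- r | P i) F i) = \sum_(i <- r | P i) real_part (F i).
Proof. exact: (big_morph _ real_partD real_part0). Qed.

Lemma real_partM r a : real_part (of_real k r * a) = r * real_part a.
Proof. by case: k a => //= -[u v]; simpc. Qed.

Lemma rnormM a b : rnorm (a * b) = rnorm a * rnorm b.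
Proof. by rewrite {1}/rnorm normrM -of_real_rnorm real_partM. Qed.

Lemma rnorm_real r : rnorm (of_real k r) = `|r|.
Proof.
have h s : 0 <= s -> rnorm (of_real k s) = s.
  by move=> s0; rewrite /rnorm ger0_norm ?of_realK// -(of_real0 R) ler_of_real.
have [r0|r0] := leP 0 r; first by rewrite h// ger0_norm.
by rewrite -{1}[r]opprK of_realN ltr0_norm// {1}/rnorm normrN [LHS]h// oppr_ge0
  ltW.
Qed.

Lemma rnorm1 : rnorm (1 : K) = 1.
Proof. by rewrite -of_real1 rnorm_real normr1. Qed.

Lemma real_part_le a : real_part a <= rnorm a.
Proof.
case: k a => [a|[u v]] /=; first exact: ler_norm.
apply: le_trans (ler_norm _) _.
by rewrite /rnorm /= -sqrtr_sqr ler_wsqrtr// lerDl sqr_ge0.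
Qed.

Lemma conj_baseD a b : conj_base (a + b) = conj_base a + conj_base b.
Proof. by case: k a b => //= a b; rewrite rmorphD. Qed.

Lemma conj_baseN (a : K) : conj_base (- a) = - conj_base a.
Proof. by case: k a => // a; exact: rmorphN. Qed.

Lemma conj_baseM a b : conj_base (a * b) = conj_base a * conj_base b.
Proof. by case: k a b => //= a b; rewrite rmorphM. Qed.

Lemma conj_base0 : conj_base (0 : K) = 0.
Proof. by case: k => //; exact: (rmorph0 (@conjc R)). Qed.

Lemma conj_real r : conj_base (of_real k r) = of_real k r.
Proof. by case: k => //; exact: conjc_real. Qed.

Lemma conj_baseK a : conj_base (conj_base a) = a.
Proof. by case: k a => // a; exact: conjcK. Qed.

Lemma rnorm_conj a : rnorm (conj_base a) = rnorm a.
Proof. by case: k a => //= -[u v]; rewrite /rnorm /= sqrrN. Qed.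

Lemma mul_conj a : a * conj_base a = of_real k (rnorm a ^+ 2).
Proof.
case: k a => [a|[u v]] /=; first by rewrite /rnorm /= real_normK ?num_real.
rewrite /rnorm /= sqr_sqrtr ?addr_ge0 ?sqr_ge0//.
by simpc; congr (_ +i* _)%C; ring.
Qed.

Lemma rnorm_sqr a : rnorm a ^+ 2 = real_part (a * conj_base a).
Proof. by rewrite mul_conj of_realK. Qed.

Lemma rnorm_sqrD a b :
  rnorm (a + b) ^+ 2 =
  rnorm a ^+ 2 + rnorm b ^+ 2 + 2 * real_part (a * conj_base b).
Proof.
have -> : real_part (a * conj_base b) = real_part (conj_base a * b).
  by case: k a b => [a b|[? ?] [? ?]] /=; simpc => /=; ring.
rewrite !rnorm_sqr conj_baseD mulrDl !mulrDr !real_partD.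
have -> : real_part (conj_base a * b) = real_part (b * conj_base a).
  by rewrite mulrC.
have -> : real_part (a * conj_base b) = real_part (b * conj_base a).
  by case: k a b => [a b|[? ?] [? ?]] /=; simpc => /=; ring.
by ring.
Qed.

Lemma rnorm_phase a : exists2 t : K, rnorm t = 1 & t * a = of_real k (rnorm a).
Proof.
have [->|a0] := eqVneq a 0.
  by exists 1; rewrite ?rnorm1// rnorm0 of_real0 mulr0.
have na0 : rnorm a != 0.
  apply: contraNN a0 => /eqP na; rewrite -normr_eq0 -of_real_rnorm na.
  by rewrite of_real0.
exists (of_real k (rnorm a)^-1 * conj_base a).
  by rewrite rnormM rnorm_real rnorm_conj ger0_norm ?invr_ge0 ?rnorm_ge0//
    mulVf.
by rewrite -mulrA [_ * a]mulrC mul_conj -of_realM expr2 mulKf.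
Qed.

End scalar_field.

Section rnorm_theory.
Variables (R : realType) (k : scalars).
Local Notation K := (base R k).

Lemma rnormD (V : normedZmodType K) (x y : V) :
  rnorm (x + y) <= rnorm x + rnorm y.
Proof. by rewrite -(ler_of_real k) of_realD !of_real_rnorm ler_normD. Qed.

Lemma rnormN (V : normedZmodType K) (x : V) : rnorm (- x) = rnorm x.
Proof. by rewrite /rnorm normrN. Qed.

Lemma rnorm_eq0 (V : normedZmodType K) (x : V) : (rnorm x == 0) = (x == 0).
Proof.
rewrite -[x == 0]normr_eq0 -of_real_rnorm.
apply/eqP/eqP => [->|h]; first by rewrite of_real0.
by rewrite -[LHS](of_realK k) h real_part0.
Qed.

Lemma rnorm_sum (V : normedZmodType K) (I : Type) (r : seq I) (P : pred I)
    (F : I -> V) :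
  rnorm (\sum_(i <- r | P i) F i) <= \sum_(i <- r | P i) rnorm (F i).
Proof.
elim/big_rec2: _ => [|i y1 y2 _ le]; first by rewrite rnorm0.
by apply: le_trans (rnormD _ _) _; rewrite lerD2l.
Qed.

Lemma rnormZ (V : normedModType K) (a : K) (x : V) :
  rnorm (a *: x) = rnorm a * rnorm x.
Proof. by rewrite {1}/rnorm normrZ -[`|a|]of_real_rnorm real_partM. Qed.

Lemma rnorm_pscale (V : normedModType K) (r : R) (x : V) :
  0 <= r -> rnorm (of_real k r *: x) = r * rnorm x.
Proof. by move=> r0; rewrite rnormZ rnorm_real ger0_norm. Qed.

Lemma real_part_sqr_le (a : K) : real_part a ^+ 2 <= rnorm a ^+ 2.
Proof.
rewrite -[leLHS]real_normK ?num_real// ler_sqr ?nnegrE ?rnorm_ge0//.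
by rewrite ler_norml real_part_le andbT lerNl -real_partN -(rnormN a)
  real_part_le.
Qed.

Lemma scalar_ball_bound (V : normedModType K) (f : V -> K) (c : R) :
  scalar f -> (forall x, rnorm x <= 1 -> rnorm (f x) <= c) ->
  forall x, rnorm (f x) <= c * rnorm x.
Proof.
move=> flin fc x.
have f0 : f 0 = 0.
  apply: (addrI (f 0)).
  by have := flin 1 0 0; rewrite scaler0 mul1r !addr0 => <-.
have [->|x0] := eqVneq x 0; first by rewrite f0 !rnorm0 mulr0.
have xp : 0 < rnorm x by rewrite lt_neqAle eq_sym rnorm_eq0 x0 rnorm_ge0.
have := fc (of_real k (rnorm x)^-1 *: x).
rewrite rnorm_pscale ?invr_ge0 ?rnorm_ge0// mulVf ?gt_eqF// => /(_ (lexx _)).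
rewrite -[_ *: x]addr0 flin f0 addr0 rnormM rnorm_real.
by rewrite ger0_norm ?invr_ge0 ?rnorm_ge0// ler_pdivrMl// mulrC.
Qed.

End rnorm_theory.

(** * Square sums *)

Lemma sum_sqr_eq0 (R : realType) J (a : 'I_J -> R) :
  \sum_j a j ^+ 2 <= 0 -> forall j, a j = 0.
Proof.
move=> h j; have : \sum_i a i ^+ 2 == 0.
  by rewrite eq_le h sumr_ge0// => i _; exact: sqr_ge0.
rewrite psumr_eq0 => [/allP/(_ j)|i _]; last exact: sqr_ge0.
by rewrite mem_index_enum sqrf_eq0 => /(_ isT)/eqP.
Qed.

Lemma cauchy_schwarz_sum (R : realType) J (a b : 'I_J -> R) (r : R) :
  0 <= r -> (forall j, 0 <= a j) -> (forall j, 0 <= b j) ->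
  \sum_j b j ^+ 2 <= r ^+ 2 ->
  \sum_j a j * b j <= Num.sqrt (\sum_j a j ^+ 2) * r.
Proof.
move=> r0 a0 b0 br; set q := Num.sqrt _.
have q0 : 0 <= q by exact: sqrtr_ge0.
have qE : \sum_j a j ^+ 2 = q ^+ 2.
  by rewrite sqr_sqrtr// sumr_ge0// => j _; rewrite sqr_ge0.
have [q00|qn0] := eqVneq q 0.
  rewrite q00 mul0r big1// => j _; rewrite (@sum_sqr_eq0 _ _ a) ?mul0r//.
  by rewrite qE q00 expr0n.
have [r00|rn0] := eqVneq r 0.
  rewrite r00 mulr0 big1// => j _; rewrite (@sum_sqr_eq0 _ _ b) ?mulr0//.
  by move: br; rewrite r00 expr0n.
have qp : 0 < q by rewrite lt_neqAle eq_sym qn0.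
have rp : 0 < r by rewrite lt_neqAle eq_sym rn0.
have : 2 * (q * r) * \sum_j a j * b j <=
    r ^+ 2 * \sum_j a j ^+ 2 + q ^+ 2 * \sum_j b j ^+ 2.
  rewrite !mulr_sumr -big_split; apply: ler_sum => j _ /=.
  rewrite -subr_ge0 (_ : _ - _ = (r * a j - q * b j) ^+ 2) ?sqr_ge0//; ring.
rewrite qE => h.
have {}h : 2 * (q * r) * \sum_j a j * b j <= 2 * (q * r) * (q * r).
  apply: le_trans h _; have := ler_wpM2l (sqr_ge0 q) br.
  by set s := \sum_j _; nra.
by move: h; rewrite ler_pM2l// !mulr_gt0.
Qed.

(** * Signs and Khintchine's inequality *)

Section signs.
Variables (R : realType) (k : scalars).
Local Notation K := (base R k).

Definition signed_sum d (e : 'I_d -> bool) (x : 'I_d -> K) : K :=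
  \sum_i (-1) ^+ e i * x i.

Definition extend_sign d (b : bool) (e : 'I_d -> bool) (i : 'I_d.+1) : bool :=
  oapp e b (unlift ord0 i).

Lemma signed_sumS d b (e : 'I_d -> bool) (x : 'I_d.+1 -> K) :
  signed_sum (extend_sign b e) x =
  signed_sum e (fun i => x (lift ord0 i)) + (-1) ^+ b * x ord0.
Proof.
rewrite /signed_sum big_ord_recl addrC /extend_sign unlift_none /=.
by congr (_ + _); apply: eq_bigr => i _; rewrite liftK.
Qed.

(** Finitely many choices of signs, each counted with weight 1/N, which behave
    like independent random signs as far as second and fourth moments are
    concerned.  A family indexed by ['I_N] makes the signed sums into row
    vectors, to which Grothendieck's inequality can be applied. *)
Definition rademacher_family N d (e : 'I_N -> 'I_d -> bool) : Prop :=
  [/\ (0 < N)%N,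
    forall x y : 'I_d -> K,
      \sum_w signed_sum (e w) x * conj_base (signed_sum (e w) y) =
      of_real k N%:R * \sum_i x i * conj_base (y i) &
    forall x : 'I_d -> K,
      \sum_w rnorm (signed_sum (e w) x) ^+ 4 <=
      3 * N%:R * (\sum_i rnorm (x i) ^+ 2) ^+ 2].

Lemma rademacher_family_sqr N d (e : 'I_N -> 'I_d -> bool) (x : 'I_d -> K) :
  rademacher_family e ->
  \sum_w rnorm (signed_sum (e w) x) ^+ 2 = N%:R * \sum_i rnorm (x i) ^+ 2.
Proof.
move=> [_ /(_ x x) /(congr1 (@real_part R k))].
rewrite real_part_sum real_partM real_part_sum.
by rewrite !(eq_bigr _ (fun i _ => esym (rnorm_sqr _))).
Qed.

(** One more sign b doubles the family.  If f is a signed sum and b a sign, then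
    |f + b x|^2 = A + B + 2bc with A = |f|^2, B = |x|^2 and c = Re (f conj x), so
    the mean over b of the fourth powers is (A + B)^2 + 4c^2, which is at most
    A^2 + 6AB + B^2.  Taking means and using that f has second moment s, this is
    at most 3s^2 + 6sB + B^2 <= 3(s + B)^2. The argument does not see whether
    the coefficients are real or complex. *)
Lemma rademacher_family_exists d : exists N (e : 'I_N -> 'I_d -> bool),
  rademacher_family e.
Proof.
elim: d => [|d [N [e eE]]].
  exists 1%N, (fun _ _ => false); split=> // [x y|x].
    by rewrite big_ord1 /signed_sum !big_ord0 mul0r mulr0.
  by rewrite big_ord1 /signed_sum !big_ord0 rnorm0 !expr0n /= mulr0.
exists (N + N)%N, (fun w => match fintype.split w with
  inl u => extend_sign false (e u) | inr u => extend_sign true (e u) end).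
have el u : fintype.split (lshift N u) = inl u by rewrite (unsplitK (inl u)).
have er u : fintype.split (rshift N u) = inr u by rewrite (unsplitK (inr u)).
have esq := rademacher_family_sqr _ eE; case: eE => N0 e2 e4.
split=> [|x y|x]; first by rewrite addn_gt0 N0.
  rewrite big_split_ord /=.
  under eq_bigr do rewrite el !signed_sumS /= !expr0 !mul1r.
  under [X in _ + X]eq_bigr do rewrite er !signed_sumS /= !expr1 !mulN1r.
  rewrite -big_split /= natrD of_realD big_ord_recl /= addrC mulrDr.
  set u := fun i => x (lift ord0 i); set v := fun i => y (lift ord0 i).
  transitivity (\sum_(w < N) (2%:R * (x ord0 * conj_base (y ord0)) +
     2%:R * (signed_sum (e w) u * conj_base (signed_sum (e w) v)))).
    by apply: eq_bigr => w _; rewrite !conj_baseD conj_baseN; ring.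
  rewrite big_split /= sumr_const card_ord -mulr_sumr e2.
  have -> : of_real k N%:R = N%:R :> K by case: (k) => //=; rewrite rmorph_nat.
  by rewrite -mulr_natr; ring.
rewrite big_split_ord /=.
under eq_bigr do rewrite el !signed_sumS /= !expr0 !mul1r.
under [X in _ + X]eq_bigr do rewrite er !signed_sumS /= !expr1 !mulN1r.
rewrite -big_split /= natrD big_ord_recl /=.
set u := fun i => x (lift ord0 i); set B := rnorm (x ord0) ^+ 2.
set s := \sum_(i < d) _.
have s0 : 0 <= s by apply: sumr_ge0 => i _; rewrite sqr_ge0.
apply: (@le_trans _ _ (\sum_(w < N) (2 * rnorm (signed_sum (e w) u) ^+ 4 +
   (12 * B * rnorm (signed_sum (e w) u) ^+ 2 + 2 * B ^+ 2)))).
  apply: ler_sum => w _.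
  rewrite -[4%N]/(2 * 2)%N !exprM !rnorm_sqrD rnormN conj_baseN mulrN
    real_partN.
  have := real_part_sqr_le (signed_sum (e w) u * conj_base (x ord0)).
  rewrite rnormM rnorm_conj exprMn -/B.
  set A := rnorm _ ^+ 2; set c := real_part _; nra.
rewrite !big_split /= sumr_const card_ord -!mulr_sumr esq -/s.
have := e4 u; rewrite -/s -[(_ * _) *+ N]mulr_natr; set n := N%:R;
  set q := \sum_w _ => qs.
have n0 : 0 <= n :> R by [].
have B0 : 0 <= B by rewrite sqr_ge0.
have h : 0 <= n * B ^+ 2 by rewrite mulr_ge0// sqr_ge0.
rewrite [leRHS](_ : _ = 6 * n * s ^+ 2 + 12 * B * (n * s) + 6 * (n * B ^+ 2));
  last by ring.
rewrite (_ : 2 * B ^+ 2 * n = 2 * (n * B ^+ 2)); last by ring.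
lra.
Qed.

(** By the fourth moment bound the second moment is not concentrated on few
    choices of signs; interpolating the second moment between the first and the
    fourth gives the constant sqrt 3. *)
Lemma khintchine N d (e : 'I_N -> 'I_d -> bool) (x : 'I_d -> K) :
  rademacher_family e ->
  N%:R * Num.sqrt (\sum_i rnorm (x i) ^+ 2) <=
  Num.sqrt 3 * \sum_w rnorm (signed_sum (e w) x).
Proof.
move=> eE; have e2 := rademacher_family_sqr x eE; have [N0 _ /(_ x) e4] := eE.
set s := \sum_i rnorm (x i) ^+ 2 in e2 e4 *.
have s0 : 0 <= s by apply: sumr_ge0 => i _; rewrite sqr_ge0.
set q := Num.sqrt s; have q0 : 0 <= q by exact: sqrtr_ge0.
have sq : s = q ^+ 2 by rewrite sqr_sqrtr.
have S0 : 0 <= \sum_w rnorm (signed_sum (e w) x).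
  by apply: sumr_ge0 => i _; exact: rnorm_ge0.
have t0 : 0 < Num.sqrt 3 :> R by rewrite sqrtr_gt0.
have t2 : Num.sqrt 3 ^+ 2 = 3 :> R by rewrite sqr_sqrtr.
set t := Num.sqrt 3 in t0 t2 *.
have [q00|qn0] := eqVneq q 0; first by rewrite ?q00 mulr0 mulr_ge0// ltW.
have qp : 0 < q by rewrite lt_neqAle eq_sym qn0.
pose r := t * q.
have r0 : 0 < r by rewrite mulr_gt0.
(* Interpolation by a polynomial: u (u - r)^2 (u + 2r) >= 0 expands to
u^4 - 3 r^2 u^2 + 2 r^3 u, and the choice r = sqrt 3 * q makes the summed
inequality sharp for the extremal moments. *)
have : 0 <= \sum_w (rnorm (signed_sum (e w) x) ^+ 4
    - 3 * r ^+ 2 * rnorm (signed_sum (e w) x) ^+ 2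
    + 2 * r ^+ 3 * rnorm (signed_sum (e w) x)).
  apply: sumr_ge0 => w _; have := rnorm_ge0 (signed_sum (e w) x).
  set u := rnorm _ => u0.
  rewrite (_ : _ + _ = u * ((u - r) ^+ 2 * (u + 2 * r))); last by ring.
  by rewrite mulr_ge0// mulr_ge0 ?sqr_ge0// addr_ge0// mulr_ge0// ltW.
rewrite !big_split /= sumrN -!mulr_sumr e2.
set S1 := \sum_w rnorm _ in S0 *; set S4 := \sum_w _ in e4 *.
rewrite sq in e4 *.
have -> : r ^+ 2 = 3 * q ^+ 2 by rewrite exprMn t2.
have -> : r ^+ 3 = 3 * (t * q ^+ 3) by rewrite exprMn (exprS t) t2; ring.
move=> h.
have {}h : q ^+ 3 * (N%:R * q) <= q ^+ 3 * (t * S1).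
  have : 2 * (3 * (t * q ^+ 3)) * S1 = 6 * (q ^+ 3 * (t * S1)) by ring.
  have : 3 * (3 * q ^+ 2) * (N%:R * q ^+ 2) = 9 * (q ^+ 3 * (N%:R * q)) by ring.
  have : 3 * N%:R * (q ^+ 2) ^+ 2 = 3 * (q ^+ 3 * (N%:R * q)) by ring.
  lra.
by move: h; rewrite ler_pM2l// exprn_gt0.
Qed.

End signs.

(** * Grothendieck's inequality *)

Section grothendieck.
Variables (R : realType) (k : scalars).
Local Notation K := (base R k).

Definition sesqui_form m n d (a : 'M[K]_(m, n)) (u : 'I_m -> 'I_d -> K)
    (v : 'I_n -> 'I_d -> K) : K :=
  \sum_(i < m) \sum_(j < n) a i j * (\sum_(l < d) u i l * conj_base (v j l)).

Definition form_bound (m n : nat) (a : 'M[K]_(m, n)) (A : R) : Prop :=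
  forall d (u : 'I_m -> 'I_d -> K) (v : 'I_n -> 'I_d -> K),
    (forall i, \sum_l rnorm (u i l) ^+ 2 <= 1) ->
    (forall j, \sum_l rnorm (v j l) ^+ 2 <= 1) ->
    rnorm (sesqui_form a u v) <= A.

Definition bilinear_bound (m n : nat) (a : 'M[K]_(m, n)) (M : R) : Prop :=
  forall (s : 'I_m -> K) (t : 'I_n -> K),
    (forall i, rnorm (s i) <= 1) -> (forall j, rnorm (t j) <= 1) ->
    rnorm (\sum_(i < m) \sum_(j < n) a i j * s i * t j) <= M.

Lemma sesqui_form_scale m n d (a : 'M[K]_(m, n)) (r s : R)
    (u : 'I_m -> 'I_d -> K) (v : 'I_n -> 'I_d -> K) :
  sesqui_form a (fun i l => of_real k r * u i l) (fun j l =>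
    of_real k s * v j l)
  = of_real k (r * s) * sesqui_form a u v.
Proof.
rewrite mulr_sumr; apply: eq_bigr => i _; rewrite mulr_sumr.
apply: eq_bigr => j _; rewrite !mulr_sumr; apply: eq_bigr => l _.
by rewrite conj_baseM conj_real of_realM; ring.
Qed.

Lemma form_bound_scale m n d (a : 'M[K]_(m, n)) (A r s : R)
    (u : 'I_m -> 'I_d -> K) (v : 'I_n -> 'I_d -> K) :
  form_bound a A -> 0 <= r -> 0 <= s ->
  (forall i, \sum_l rnorm (u i l) ^+ 2 <= r ^+ 2) ->
  (forall j, \sum_l rnorm (v j l) ^+ 2 <= s ^+ 2) ->
  rnorm (sesqui_form a u v) <= A * (r * s).
Proof.
move=> aA r0 s0 ur vs.
have [r00|rn0] := eqVneq r 0.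
  rewrite /sesqui_form big1 ?rnorm0 ?r00 ?mul0r ?mulr0// => i _.
  rewrite big1// => j _; rewrite big1 ?mulr0// => l _.
  have := ur i; rewrite r00 expr0n => /sum_sqr_eq0/(_ l)/eqP.
  by rewrite rnorm_eq0 => /eqP ->; rewrite mul0r.
have [s00|sn0] := eqVneq s 0.
  rewrite /sesqui_form big1 ?rnorm0 ?s00 ?mulr0// => i _.
  rewrite big1// => j _; rewrite big1 ?mulr0// => l _.
  have := vs j; rewrite s00 expr0n => /sum_sqr_eq0/(_ l)/eqP.
  by rewrite rnorm_eq0 => /eqP ->; rewrite conj_base0 mulr0.
have nrm c e (w : 'I_e -> K) : 0 <= c -> c != 0 ->
    \sum_l rnorm (w l) ^+ 2 <= c ^+ 2 ->
    \sum_l rnorm (of_real k c^-1 * w l) ^+ 2 <= 1.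
  move=> c0 cn0; under [X in _ -> X <= _]eq_bigr do rewrite rnormM exprMn
    rnorm_real.
  by rewrite -mulr_sumr real_normK ?num_real// exprVn ler_pdivrMl ?mulr1//
    exprn_gt0// lt_neqAle eq_sym cn0.
have := aA d _ _ (fun i => nrm r d _ r0 rn0 (ur i)) (fun j =>
  nrm s d _ s0 sn0 (vs j)).
rewrite sesqui_form_scale rnormM rnorm_real -invfM ger0_norm ?invr_ge0
  ?mulr_ge0//.
by rewrite ler_pdivrMl 1?mulrC// lt_neqAle eq_sym mulf_neq0// mulr_ge0.
Qed.

(** The start of the iteration: a bound that is uniform in the dimension. *)
Lemma form_bound_crude m n (a : 'M[K]_(m, n)) :
  form_bound a (\sum_i \sum_j rnorm (a i j)).
Proof.
move=> d u v u1 v1.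
apply: le_trans (rnorm_sum _ _ _) _; apply: ler_sum => i _.
apply: le_trans (rnorm_sum _ _ _) _; apply: ler_sum => j _.
rewrite rnormM ler_piMr ?rnorm_ge0//.
apply: le_trans (rnorm_sum _ _ _) _.
have : 2 * \sum_l rnorm (u i l * conj_base (v j l)) <=
       \sum_l rnorm (u i l) ^+ 2 + \sum_l rnorm (v j l) ^+ 2.
  rewrite mulr_sumr -big_split; apply: ler_sum => l _ /=.
  rewrite rnormM rnorm_conj -subr_ge0.
  rewrite (_ : _ - _ = (rnorm (u i l) - rnorm (v j l)) ^+ 2) ?sqr_ge0//; ring.
have := u1 i; have := v1 j; lra.
Qed.

Definition truncate (M : R) (z : K) : K :=
  if rnorm z <= M then z else of_real k (M / rnorm z) * z.

Lemma truncate_le M z : 0 < M -> rnorm (truncate M z) <= M.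
Proof.
move=> M0; rewrite /truncate; case: ifPn => //; rewrite -ltNge => Mz.
rewrite rnormM rnorm_real ger0_norm ?divr_ge0 ?rnorm_ge0 ?(ltW M0)//.
by rewrite divfK// gt_eqF// (lt_trans M0).
Qed.

Lemma truncate_le_norm M z : 0 < M -> rnorm (truncate M z) <= rnorm z.
Proof.
move=> M0; rewrite /truncate; case: ifPn => //; rewrite -ltNge => Mz.
have z0 : 0 < rnorm z by exact: lt_trans Mz.
rewrite rnormM rnorm_real ger0_norm ?divr_ge0 ?rnorm_ge0 ?(ltW M0)//.
by rewrite divfK ?gt_eqF// ltW.
Qed.

(** If t > M, the excess t - M is at most t^2 / (4M), since (t - 2M)^2 >= 0. *)
Lemma truncate_error M z : 0 < M ->
  4 * M * rnorm (z - truncate M z) <= rnorm z ^+ 2.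
Proof.
move=> M0; rewrite /truncate; case: ifPn => [_|];
  first by rewrite subrr rnorm0 mulr0 sqr_ge0.
rewrite -ltNge => Mz; have z0 : 0 < rnorm z by exact: lt_trans Mz.
rewrite -{1}[z]mul1r -(of_real1 R) -mulrBl -of_realN -of_realD rnormM
  rnorm_real.
rewrite ger0_norm ?subr_ge0 ?ler_pdivrMr ?mul1r ?(ltW Mz)// mulrBl mul1r divfK
  ?gt_eqF//.
rewrite -subr_ge0 (_ : _ - _ = (rnorm z - 2 * M) ^+ 2) ?sqr_ge0//; ring.
Qed.

Lemma bilinear_bound_scale m n (a : 'M[K]_(m, n)) M r s
    (u : 'I_m -> K) (v : 'I_n -> K) :
  bilinear_bound a M -> 0 < r -> 0 < s ->
  (forall i, rnorm (u i) <= r) -> (forall j, rnorm (v j) <= s) ->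
  rnorm (\sum_(i < m) \sum_(j < n) a i j * u i * v j) <= M * (r * s).
Proof.
move=> aM r0 s0 ur vs.
have nrm c (w : K) : 0 < c -> rnorm w <= c -> rnorm (of_real k c^-1 * w) <= 1.
  move=> c0 wc; rewrite rnormM rnorm_real gtr0_norm ?invr_gt0//.
  by rewrite ler_pdivrMl// mulr1.
have := aM _ _ (fun i => nrm r _ r0 (ur i)) (fun j => nrm s _ s0 (vs j)).
rewrite (_ : \sum_i _ = of_real k (r * s)^-1 * \sum_i \sum_j a i j * u i * v j).
  rewrite rnormM rnorm_real gtr0_norm ?invr_gt0 ?mulr_gt0//.
  by rewrite ler_pdivrMl 1?mulrC// mulr_gt0.
rewrite mulr_sumr; apply: eq_bigr => i _; rewrite mulr_sumr.
by apply: eq_bigr => j _; rewrite invfM of_realM; ring.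
Qed.

Lemma exchange_form m n d (a : 'M[K]_(m, n)) (u : 'I_m -> 'I_d -> K)
    (v : 'I_n -> 'I_d -> K) :
  sesqui_form a u v =
  \sum_l \sum_i \sum_j a i j * u i l * conj_base (v j l).
Proof.
rewrite exchange_big; apply: eq_bigr => i _; rewrite exchange_big.
by apply: eq_bigr => j _; rewrite mulr_sumr; apply: eq_bigr => l _;
  rewrite mulrA.
Qed.

Lemma sesqui_formBl m n d (a : 'M[K]_(m, n)) (u u' : 'I_m -> 'I_d -> K)
    (v : 'I_n -> 'I_d -> K) :
  sesqui_form a (fun i l => u i l - u' i l) v =
  sesqui_form a u v - sesqui_form a u' v.
Proof.
rewrite /sesqui_form -sumrB; apply: eq_bigr => i _; rewrite -sumrB.
apply: eq_bigr => j _; rewrite -mulrBr; congr (_ * _); rewrite -sumrB.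
by apply: eq_bigr => l _; rewrite mulrBl.
Qed.

Lemma sesqui_formBr m n d (a : 'M[K]_(m, n)) (u : 'I_m -> 'I_d -> K)
    (v v' : 'I_n -> 'I_d -> K) :
  sesqui_form a u (fun i l => v i l - v' i l) =
  sesqui_form a u v - sesqui_form a u v'.
Proof.
rewrite /sesqui_form -sumrB; apply: eq_bigr => i _; rewrite -sumrB.
apply: eq_bigr => j _; rewrite -mulrBr; congr (_ * _); rewrite -sumrB.
by apply: eq_bigr => l _; rewrite conj_baseD conj_baseN mulrBr.
Qed.

(** Inner products of vectors x_i and y_j are means of products of their signed
    sums.  Truncate these at sqrt 3.  The products of the truncated sums are
    handled, for each choice of signs, by the bilinear bound, and contribute 3.
    The errors have mean square at most 3 / 48 = (1/4)^2 by the fourth moment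
    bound, so that each of the two remaining terms is a value of the same form
    at vectors of norms 1/4 and 1, and contributes A / 4. *)
Lemma form_bound_step m n (a : 'M[K]_(m, n)) A :
  bilinear_bound a 1 -> form_bound a A -> form_bound a (3 + A / 2).
Proof.
move=> a1 aA d x y x1 y1.
have [N [e eE]] := rademacher_family_exists R k d.
have [N0 e2 e4] := eE.
pose n_ : R := N%:R; have n0 : 0 < n_ by rewrite ltr0n.
pose M : R := Num.sqrt 3.
have M0 : 0 < M by rewrite sqrtr_gt0.
have M2 : M ^+ 2 = 3 by rewrite sqr_sqrtr.
pose g (p : nat) (z : 'I_p -> 'I_d -> K) i w := signed_sum (e w) (z i).
pose f (p : nat) (z : 'I_p -> 'I_d -> K) i w := truncate M (g p z i w).
have sn0 : 0 <= Num.sqrt n_ by exact: sqrtr_ge0.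
have sn2 : Num.sqrt n_ ^+ 2 = n_ by rewrite sqr_sqrtr// ltW.
have gn p z : (forall i, \sum_l rnorm (z i l) ^+ 2 <= 1) ->
    forall i, \sum_w rnorm (g p z i w) ^+ 2 <= Num.sqrt n_ ^+ 2.
  move=> z1 i; rewrite (rademacher_family_sqr (z i) eE) sn2 -[leRHS]mulr1.
  by rewrite ler_wpM2l// ltW.
have fn p z : (forall i, \sum_l rnorm (z i l) ^+ 2 <= 1) ->
    forall i, \sum_w rnorm (f p z i w) ^+ 2 <= Num.sqrt n_ ^+ 2.
  move=> z1 i; apply: le_trans (gn _ _ z1 i); apply: ler_sum => w _.
  by rewrite ler_sqr ?nnegrE ?rnorm_ge0// truncate_le_norm.
have rn p z : (forall i, \sum_l rnorm (z i l) ^+ 2 <= 1) ->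
    forall i, \sum_w rnorm (g p z i w - f p z i w) ^+ 2 <= (Num.sqrt n_ / 4) ^+
      2.
  move=> z1 i.
  have h : \sum_w rnorm (g p z i w) ^+ 4 <= 3 * n_.
    apply: le_trans (e4 (z i)) _;
      rewrite -[leRHS]mulr1 ler_wpM2l ?mulr_ge0 ?(ltW n0)//.
    by rewrite -[leRHS](expr1n _ 2) ler_sqr ?nnegrE ?sumr_ge0// => l _;
      rewrite sqr_ge0.
  have : 48 * \sum_w rnorm (g p z i w - f p z i w) ^+ 2 <=
      \sum_w rnorm (g p z i w) ^+ 4.
    rewrite mulr_sumr; apply: ler_sum => w _.
    have := truncate_error (g p z i w) M0; rewrite -/(f p z i w) => tr.
    rewrite (_ : 48 = (4 * M) ^+ 2); last by rewrite exprMn M2; ring.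
    rewrite -exprMn -[4%N]/(2 * 2)%N exprM ler_sqr ?nnegrE ?sqr_ge0//.
    by rewrite mulr_ge0 ?rnorm_ge0// mulr_ge0// ltW.
  rewrite exprMn sn2 => h'; rewrite (_ : 4^-1 ^+ 2 = 16^-1); last by field.
  lra.
(* Telescoping, with a conjugation on the second factors:
g g' = f f' + (g - f) g' + f (g' - f'). *)
have key : of_real k n_ * sesqui_form a x y =
    sesqui_form a (f m x) (f n y) +
    (sesqui_form a (fun i l => g m x i l - f m x i l) (g n y) +
     sesqui_form a (f m x) (fun j l => g n y j l - f n y j l)).
  rewrite sesqui_formBl sesqui_formBr.
  rewrite [RHS](_ : _ = sesqui_form a (g m x) (g n y)); last by ring.
  rewrite mulr_sumr; apply: eq_bigr => i _; rewrite mulr_sumr.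
  by apply: eq_bigr => j _; rewrite mulrCA -e2.
have b1 : rnorm (sesqui_form a (f m x) (f n y)) <= 3 * n_.
  rewrite exchange_form; apply: le_trans (rnorm_sum _ _ _) _.
  apply: (@le_trans _ _ (\sum_(w < N) 3)); last first.
    by rewrite sumr_const card_ord -[leLHS]mulr_natr.
  apply: ler_sum => w _; rewrite -M2 expr2 -[leRHS]mul1r.
  by apply: bilinear_bound_scale => // i; rewrite ?rnorm_conj truncate_le.
have b2 := form_bound_scale aA (divr_ge0 sn0 (ler0n _ 4)) sn0 (rn m x x1) (gn n
  y y1).
have b3 := form_bound_scale aA sn0 (divr_ge0 sn0 (ler0n _ 4)) (fn m x x1) (rn n
  y y1).
have E : A * (Num.sqrt n_ / 4 * Num.sqrt n_) = A * n_ / 4 by rewrite -{3}sn2;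
  ring.
have E' : A * (Num.sqrt n_ * (Num.sqrt n_ / 4)) = A * n_ / 4 by rewrite
  -{3}sn2; ring.
rewrite E in b2; rewrite E' in b3.
have : n_ * rnorm (sesqui_form a x y) <= n_ * (3 + A / 2).
  rewrite -[n_ in leLHS]ger0_norm ?(ltW n0)// -(rnorm_real k) -rnormM key.
  apply: le_trans (rnormD _ _) _.
  apply: le_trans (lerD (lexx _) (rnormD _ _)) _.
  apply: le_trans (lerD b1 (lerD b2 b3)) _; lra.
by rewrite ler_pM2l.
Qed.

(** The bound 6 is the fixed point of the contraction A |-> 3 + A / 2. *)
Lemma bilinear_bound_form_bound m n (a : 'M[K]_(m, n)) :
  bilinear_bound a 1 -> form_bound a 6.
Proof.
move=> a1; set A := \sum_i \sum_j rnorm (a i j).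
have A0 : 0 <= A by do 2 (apply: sumr_ge0 => ? _); exact: rnorm_ge0.
have aA N : form_bound a (6 + A / 2 ^+ N).
  elim: N => [|N IH].
    by move=> d u v u1 v1; apply: le_trans (form_bound_crude _ u1 v1) _;
      rewrite -/A expr0; lra.
  have := form_bound_step a1 IH; rewrite (_ : 3 + _ = 6 + A / 2 ^+ N.+1)//.
  by rewrite exprS; field; rewrite expf_neq0.
move=> d u v u1 v1; rewrite leNgt; apply/negP => lt6.
set t := rnorm _ in lt6; pose N := Num.truncn (A / (t - 6)).
have tp : 0 < t - 6 by rewrite subr_gt0.
have := aA N.+1 _ _ _ u1 v1; rewrite -/t; apply/negP; rewrite -ltNge.
rewrite -ltrBrDl ltr_pdivrMr ?exprn_gt0// mulrC -ltr_pdivrMr//.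
apply: lt_trans (truncnS_gt _) _.
by rewrite -natrX ltr_nat ltn_expl.
Qed.

Theorem grothendieck_inequality : @grothendieck_bound R k 6.
Proof.
move=> m n d a x y a1 x1 y1.
have h p (z : 'I_p -> 'rV[K]_d) :
    (forall i, Num.sqrt (\sum_l rnorm (z i 0 l) ^+ 2) <= 1) ->
    forall i, \sum_l rnorm (z i 0 l) ^+ 2 <= 1.
  move=> z1 i; rewrite -ler_sqrt// sqrtr1; exact: z1.
exact: (bilinear_bound_form_bound a1 (h _ _ x1) (h _ _ y1)).
Qed.

Lemma grothendieck_bound_ge0 C : @grothendieck_bound R k C -> 0 <= C.
Proof.
move=> /(_ 0%N 0%N 0%N 0 (fun=> 0) (fun=> 0)); rewrite !big_ord0 rnorm0.
apply=> [|[]//|[]//]; by move=> s t _ _; rewrite big_ord0 rnorm0.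
Qed.

Lemma grothendieck_constant_ge0 : 0 <= grothendieck_constant R k.
Proof.
apply: lb_le_inf; first by exists 6; exact: grothendieck_inequality.
by move=> C; exact: grothendieck_bound_ge0.
Qed.

(** Each bound is at least the left-hand side, and there is some bound: the
    infimum of an empty set would be 0. *)
Lemma grothendieck_constantP :
  @grothendieck_bound R k (grothendieck_constant R k).
Proof.
move=> m n d a x y a1 x1 y1; apply: lb_le_inf.
  by exists 6; exact: grothendieck_inequality.
by move=> C; apply.
Qed.

(** The homogeneous form of the inequality; M, r and s may vanish. *)
Lemma grothendieck_form m n d (a : 'M[K]_(m, n)) (M r s : R)
    (u : 'I_m -> 'I_d -> K) (v : 'I_n -> 'I_d -> K) :
  0 <= M -> bilinear_bound a M -> 0 <= r -> 0 <= s ->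
  (forall i, \sum_l rnorm (u i l) ^+ 2 <= r ^+ 2) ->
  (forall j, \sum_l rnorm (v j l) ^+ 2 <= s ^+ 2) ->
  rnorm (sesqui_form a u v) <= grothendieck_constant R k * M * (r * s).
Proof.
move=> M0 aM r0 s0 ur vs.
set C := grothendieck_constant R k.
have C0 : 0 <= C by exact: grothendieck_constant_ge0.
have pos M' : 0 < M' -> bilinear_bound a M' ->
    rnorm (sesqui_form a u v) <= C * M' * (r * s).
  move=> M'0 aM'.
  apply: form_bound_scale => // d' u' v' u'1 v'1.
  have b1 : bilinear_bound (of_real k M'^-1 *: a) 1.
    move=> p q p1 q1.
    rewrite (_ : \sum_i _ = of_real k M'^-1 * \sum_i \sum_j a i j * p i * q j).
      rewrite rnormM rnorm_real gtr0_norm ?invr_gt0// ler_pdivrMl// mulr1.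
      exact: aM'.
    rewrite mulr_sumr; apply: eq_bigr => i _; rewrite mulr_sumr.
    by apply: eq_bigr => j _; rewrite mxE; ring.
  have := @grothendieck_constantP m n d' _ (fun i => \row_l u' i l)
    (fun j => \row_l v' j l) b1.
  rewrite -/C (_ : \sum_i _ = of_real k M'^-1 * sesqui_form a u' v').
    rewrite rnormM rnorm_real gtr0_norm ?invr_gt0// ler_pdivrMl// mulrC.
    apply => i; rewrite -sqrtr1 ler_wsqrtr//; under eq_bigr do rewrite mxE;
      [exact: u'1|exact: v'1].
  rewrite /sesqui_form mulr_sumr; apply: eq_bigr => i _; rewrite mulr_sumr.
  apply: eq_bigr => j _; rewrite mxE -mulrA; congr (_ * (_ * _)).
  by apply: eq_bigr => l _; rewrite !mxE.
(* M = 0 cannot be normalised to 1; it is the limit of positive bounds. *)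
have [M00|Mn0] := eqVneq M 0; last by apply: pos => //;
  rewrite lt_neqAle eq_sym Mn0.
rewrite M00 mulr0 mul0r -[leRHS]addr0; apply/ler_addgt0Pl => eps eps0.
have q0 : 0 < C * (r * s) + 1 by rewrite ltr_wpDl ?mulr_ge0.
have e0 : 0 < eps / (C * (r * s) + 1) by rewrite divr_gt0.
apply: le_trans (pos _ e0 _) _.
  by move=> p q p1 q1; apply: le_trans (aM _ _ p1 q1) _; rewrite M00 ltW.
rewrite !addr0 mulrAC [_ * (eps / _)]mulrA ler_pdivrMr// mulrC.
by rewrite ler_wpM2l ?(ltW eps0)// lerDl.
Qed.

End grothendieck.

(** * The Hahn-Banach theorem over the reals and the complex numbers *)

(** In the complex case, f(x) = F(x) - i F(ix). *)
Lemma linear_of_real_part (R : realType) (k : scalars)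
    (X : normedModType (base R k)) (F : X -> R) :
  (forall (r : R) x y, F (of_real k r *: x + y) = r * F x + F y) ->
  exists2 f : X -> base R k, scalar f & forall x, real_part (f x) = F x.
Proof.
case: k X F => X F /= lin; first by exists F.
have F0 : F 0 = 0 by apply: (addrI (F 0)); have := lin 1 0 0;
  rewrite scaler0 mul1r !addr0 => <-.
have FZ (r : R) x : F (r%:C%C *: x) = r * F x by rewrite -[_ *: x]addr0 lin F0
  addr0.
have FD x y : F (x + y) = F x + F y by rewrite -[x]scale1r (lin 1) mul1r
  scale1r.
pose f x : R[i]%C := (F x +i* - F ('i%C *: x))%C.
exists f => [[u v] x y|x //]; rewrite /f.
have E1 : (u +i* v)%C *: x + y = u%:C%C *: x + (v%:C%C *: ('i%C *: x) + y).
  by rewrite addrA scalerA -scalerDl; congr (_ *: _ + _); simpc.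
have E2 : 'i%C *: ((u +i* v)%C *: x + y) =
    u%:C%C *: ('i%C *: x) + ((- v)%:C%C *: x + 'i%C *: y).
  by rewrite addrA scalerDr !scalerA -scalerDl; congr (_ *: _ + _); simpc.
by rewrite E2 E1 !FD !FZ; simpc; congr (_ +i* _)%C; ring.
Qed.

Section hahn_banach.
Variables (R : realType) (k : scalars) (X : normedModType (base R k)).
Local Notation K := (base R k).

(** G is the graph of a real-linear functional on a real subspace, dominated by
    V times the norm.  No clause says that G is single-valued: if (0, r) is in G,
    then so is (0, - r), and domination forces r = 0. *)
Definition dominated (V : R) (G : set (X * R)) : Prop :=
  (forall (r : R) p q, G p -> G q ->
     G (of_real k r *: p.1 + q.1, r * p.2 + q.2)) /\
  (forall p, G p -> p.2 <= V * rnorm p.1).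

(** The value s at the new vector x0 must satisfy
    f(x) - V |x - x0| <= s <= V |y + x0| - f(y) for all x and y in the domain;
    the triangle inequality leaves room for it. *)
Lemma dominated_extend (V : R) (G : set (X * R)) (x0 : X) :
  0 <= V -> dominated V G -> G (0, 0) ->
  exists s : R, dominated V
    [set (p.1 + of_real k a *: x0, p.2 + a * s) | p in G & a in [set: R]].
Proof.
move=> V0 [Glin Gle] G0.
pose S : set R := [set p.2 - V * rnorm (p.1 - x0) | p in G].
have SleG p q : G p -> G q -> p.2 - V * rnorm (p.1 - x0) <= V * rnorm (q.1 +
  x0) - q.2.
  move=> Gp Gq; have := Gle _ (Glin 1 _ _ Gp Gq);
    rewrite /= of_real1 scale1r mul1r => le1.
  have : rnorm (p.1 + q.1) <= rnorm (p.1 - x0) + rnorm (q.1 + x0).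
    by apply: le_trans _ (rnormD _ _); rewrite addrACA addNr addr0.
  move=> /(ler_wpM2l V0); rewrite mulrDr; lra.
have Ssup : has_sup S.
  split; first by exists (0 - V * rnorm (0 - x0)), (0, 0).
  by exists (V * rnorm (0 + x0) - 0) => _ [p Gp <-]; exact: (SleG p (0, 0)).
have Sle p : G p -> p.2 - V * rnorm (p.1 - x0) <= sup S.
  by move=> Gp; apply: ub_le_sup; [exact: (proj2 Ssup)|exists p].
have leS q : G q -> sup S <= V * rnorm (q.1 + x0) - q.2.
  by move=> Gq; apply: ge_sup; [exact: (proj1 Ssup)|move=> _ [p Gp <-];
    exact: SleG].
have GZ r p : G p -> G (of_real k r *: p.1, r * p.2).
  by move=> Gp; have := Glin r _ _ Gp G0; rewrite /= !addr0.
exists (sup S); split=> [r _ _ [p Gp [a _ <-]] [q Gq [b _ <-]]|_ [p Gp [a _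
  <-]]] /=.
  exists (of_real k r *: p.1 + q.1, r * p.2 + q.2); first exact: Glin.
  exists (r * a + b) => //=; congr pair; last by ring.
  by rewrite scalerDr of_realD of_realM scalerDl scalerA addrACA.
have [a0|a0|->] := ltgtP a 0; last first.
- by rewrite of_real0 scale0r mul0r !addr0; exact: Gle.
- have := leS _ (GZ a^-1 _ Gp); rewrite /= => /(ler_wpM2l (ltW a0)).
  rewrite mulrBr mulVKf ?gt_eqF// mulrCA -(rnorm_pscale _ (ltW a0)).
  rewrite scalerDr scalerA -of_realM mulfV ?gt_eqF// of_real1 scale1r; lra.
have b0 : 0 < - a by rewrite oppr_gt0.
have := Sle _ (GZ (- a)^-1 _ Gp); rewrite /= => /(ler_wpM2l (ltW b0)).
rewrite mulrBr mulVKf ?gt_eqF// mulrCA -(rnorm_pscale _ (ltW b0)).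
rewrite scalerBr scalerA -of_realM mulfV ?gt_eqF// of_real1 scale1r.
by rewrite of_realN scaleNr opprK; lra.
Qed.

(** Zorn's lemma gives a maximal dominated graph; [dominated_extend] shows that
    its domain is the whole space. *)
Lemma hahn_banach_real (V : R) (G : set (X * R)) :
  0 <= V -> dominated V G -> G (0, 0) ->
  exists F : X -> R,
    [/\ forall (r : R) x y, F (of_real k r *: x + y) = r * F x + F y,
        forall x, F x <= V * rnorm x &
        forall p, G p -> F p.1 = p.2].
Proof.
move=> V0 GV G0.
(* The empty chain has an empty union, hence the condition that only
   nonempty graphs extend G. *)
pose P (A : set (X * R)) := dominated V A /\ (A !=set0 -> G `<=` A).
have [A [[AV GA] Amax]] : exists A, P A /\ forall B, A `<` B -> ~ P B.
  apply: Zorn_bigcup => F FP Ftot; split; last first.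
    by move=> [p [A FA Ap]] q Gq; exists A => //;
      apply: (proj2 (FP A FA)) => //; exists p.
  split=> [r p q [A FA Ap] [B FB Bq]|p [A FA Ap]];
    last exact: (proj2 (proj1 (FP A FA))).
  have [AB|BA] := Ftot _ _ FA FB.
    by exists B => //; apply: (proj1 (proj1 (FP B FB))) => //; exact: AB.
  by exists A => //; apply: (proj1 (proj1 (FP A FA))) => //; exact: BA.
have An0 : A !=set0.
  apply: contrapT => /nonemptyPn A0; apply: (Amax G); last by split=> // _;
    exact: subset_refl.
  by rewrite A0; split=> // /(_ _ G0).
have {}GA := GA An0; have A0 := GA _ G0.
have Atot x : exists r, A (x, r).
  have [s BV] := dominated_extend x V0 AV A0.
  set B := (X in dominated V X) in BV.
  have AB : A `<=` B.
    by move=> [y r] Ayr; exists (y, r) => //; exists 0;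
      rewrite //= of_real0 scale0r mul0r !addr0.
  have Bx : B (x, s).
    by exists (0, 0) => //; exists 1; rewrite //= of_real1 scale1r mul1r !add0r.
  exists s; apply: contrapT => nA; apply: (Amax B).
    by split=> // /(_ _ Bx).
  by split=> // _; exact: subset_trans AB.
have Auniq x r s : A (x, r) -> A (x, s) -> r = s.
  have le r' s' : A (x, r') -> A (x, s') -> s' <= r'.
    move=> Ar As; have := proj2 AV _ (proj1 AV (-1) _ _ Ar As).
    by rewrite /= of_realN of_real1 scaleN1r addNr rnorm0 mulr0; lra.
  by move=> Ar As; apply/eqP; rewrite eq_le !le.
have [F AF] := choice Atot.
exists F; split=> [r x y|x|[x r] /GA Ap]; first 1 last.
- exact: (proj2 AV _ (AF x)).
- exact: Auniq (AF x) Ap.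
- apply: Auniq (AF _) _; exact: (proj1 AV r _ _ (AF x) (AF y)).
Qed.

Lemma dual_mem (f : X -> K) (V : R) : scalar f ->
  (forall x, rnorm (f x) <= V * rnorm x) -> f \in @dual_pred R k X.
Proof.
move=> lf fV; apply/mem_set; split=> //.
pose g : {linear X -> K^o} :=
  HB.pack (f : X -> K^o) (GRing.isLinear.Build _ _ _ _ (f : X -> K^o) lf).
apply: (@bounded_linear_continuous _ _ _ g).
apply/linear_boundedP; near=> M => x.
rewrite -[`|x|]of_real_rnorm -[`|_|]of_real_rnorm.
apply: (@le_trans _ _ (of_real k V * of_real k (rnorm x))).
  by rewrite -of_realM ler_of_real.
rewrite ler_wpM2r// -?(of_real0 R k) ?ler_of_real ?rnorm_ge0//.
near: M; apply: nbhs_pinfty_ge;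
  by rewrite realE -(of_real0 R k) !ler_of_real le_total.
Unshelve. all: by end_near.
Qed.

Lemma real_part_inj (a b : K) :
  (forall t : K, real_part (t * a) = real_part (t * b)) -> a = b.
Proof.
move=> h; apply/eqP; rewrite -subr_eq0 -(rnorm_eq0 (a - b)) -sqrf_eq0 rnorm_sqr.
by rewrite mulrC mulrBr real_partD real_partN h subrr.
Qed.

(** Extend the real part, and recover the functional from its real part.  The
    norm does not grow, since |g(x)| is the real part of g(t x) for some scalar
    t of modulus 1. *)
Lemma hahn_banach (H : set X) (f : X -> K) (V : R) :
  0 <= V -> H 0 ->
  (forall (a : K) x y, H x -> H y -> H (a *: x + y)) ->
  (forall (a : K) x y, H x -> H y -> f (a *: x + y) = a * f x + f y) ->
  (forall x, H x -> rnorm (f x) <= V * rnorm x) ->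
  exists2 g : dual X, rnorm g <= V & forall x, H x -> g x = f x.
Proof.
move=> V0 H0 Hlin flin fV.
pose G := [set (x, real_part (f x)) | x in H].
have f0 : f 0 = 0.
  by apply: (addrI (f 0)); have := flin 1 0 0 H0 H0;
    rewrite scaler0 mul1r !addr0 => <-.
have GV : dominated V G.
  split=> [r _ _ [x Hx <-] [y Hy <-]|_ [x Hx <-]] /=.
    by exists (of_real k r *: x + y);
      [exact: Hlin|rewrite flin// real_partD real_partM].
  exact: le_trans (real_part_le _) (fV x Hx).
have G0 : G (0, 0) by exists 0; rewrite // f0 real_part0.
have [F [Flin FV FG]] := hahn_banach_real V0 GV G0.
have [g glin gF] := linear_of_real_part Flin.
have gZ a x : g (a *: x) = a * g x.
  have g0 : g 0 = 0.
    by apply: (addrI (g 0)); have := glin 1 0 0;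
      rewrite scaler0 mul1r !addr0 => <-.
  by rewrite -[a *: x]addr0 glin g0 addr0.
have gV x : rnorm (g x) <= V * rnorm x.
  have [t t1 tE] := rnorm_phase (g x).
  rewrite -[leLHS](of_realK k) -tE -gZ gF; apply: le_trans (FV _) _.
  by rewrite rnormZ t1 mul1r.
exists (Dual (dual_mem glin gV)) => [|x Hx /=].
  rewrite rnorm_dual; apply: dual_opnorm_le => x x1 /=.
  by apply: le_trans (gV x) _; rewrite ler_piMr.
apply: real_part_inj => t; rewrite -gZ gF.
have Htx : H (t *: x) by rewrite -[t *: x]addr0; exact: Hlin.
rewrite (FG (t *: x, _) (imageP _ Htx)).
by rewrite /= -[t *: x]addr0 flin// f0 addr0.
Qed.

End hahn_banach.

(** * Coordinates in L_oo spaces *)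

Section finite_span.
Variables (K : fieldType) (V : lmodType K).

(** Local l_oo structure is available around subspaces with a basis; this puts
    finitely many vectors into one. *)
Lemma free_family_spanning J (x : 'I_J -> V) : exists d (e : 'I_d -> V),
  (forall c : 'I_d -> K, \sum_i c i *: e i = 0 -> forall i, c i = 0) /\
  forall j, exists c : 'I_d -> K, x j = \sum_i c i *: e i.
Proof.
elim: J x => [|J IH] x.
  by exists 0%N, (fun=> 0); split=> [c _ []|[]].
have [d [e [efree xe]]] := IH (fun j => x (lift ord0 j)).
have [[c0 x0]|x0] := pselect (exists c : 'I_d -> K, x ord0 = \sum_i c i *: e i).
  exists d, e; split=> // j; case: (unliftP ord0 j) => [j'|] ->;
    last by exists c0.
  exact: xe.
pose e' (i : 'I_d.+1) := oapp e (x ord0) (unlift ord0 i).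
have sume (c : 'I_d.+1 -> K) :
    \sum_i c i *: e' i = c ord0 *: x ord0 + \sum_i c (lift ord0 i) *: e i.
  rewrite big_ord_recl /e' unlift_none /=; congr (_ + _).
  by apply: eq_bigr => i _; rewrite liftK.
exists d.+1, e'; split=> [c|j].
  rewrite sume => c0.
  have c00 : c ord0 = 0.
    apply/eqP/negPn/negP => cn0; apply: x0.
    exists (fun i => - (c ord0)^-1 * c (lift ord0 i)).
    under eq_bigr do rewrite -scalerA.
    rewrite -scaler_sumr scaleNr -scalerN; move: c0 => /eqP;
      rewrite addr_eq0 => /eqP <-.
    by rewrite scalerA mulVf// scale1r.
  move=> i; case: (unliftP ord0 i) => [i'|] -> //.
  move: c0; rewrite c00 scale0r add0r => /efree; exact.
case: (unliftP ord0 j) => [j'|] ->.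
  have [c xc] := xe j'; exists (fun i => oapp c 0 (unlift ord0 i)).
  rewrite sume unlift_none /= scale0r add0r xc.
  by apply: eq_bigr => i _; rewrite liftK.
exists (fun i => (i == ord0)%:R);
  rewrite sume eqxx scale1r big1 ?addr0// => i _.
by rewrite eq_sym (negbTE (neq_lift _ _)) scale0r.
Qed.

End finite_span.

Section coordinates.
Variables (R : realType) (k : scalars).
Local Notation K := (base R k).

Lemma rnorm_rowP m (y : 'rV[K]_m) (r : R) : 0 <= r ->
  rnorm y <= r <-> forall l, rnorm (y 0 l) <= r.
Proof.
move=> r0; split=> [yr l|yr].
  apply: le_trans yr; rewrite -(ler_of_real k) !of_real_rnorm.
  rewrite [leRHS]/Num.norm /= mx_normE -[leLHS]nngE num_le.
  exact: (le_bigmax _ (fun i : 'I_1 * 'I_m => `|y i.1 i.2|%:nng) (0, l)).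
have [->|yn0] := eqVneq y 0; first by rewrite rnorm0.
have : mx_norm y != 0 by apply: contraNN yn0 => /eqP/mx_norm_eq0 ->.
move=> /mx_norm_neq0 [[i j] /= E].
by rewrite -(ler_of_real k) of_real_rnorm [leLHS]E ord1 -of_real_rnorm
  ler_of_real.
Qed.

(** Continuity at 0 along H bounds f on the unit ball of H, so that the supremum
    that defines the norm is a genuine one. *)
Lemma opnorm_on_ge (V W : normedModType K) (H : set V) (f : V -> W) :
  H 0 -> (forall (a : K) x y, H x -> H y -> H (a *: x + y)) ->
  (forall (a : K) x y, H x -> H y -> f (a *: x + y) = a *: f x + f y) ->
  {within H, continuous f} ->
  0 <= opnorm_on H f /\ forall x, H x -> rnorm (f x) <= opnorm_on H f * rnorm x.
Proof.
move=> H0 Hlin flin fcont.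
have f0 : f 0 = 0.
  by apply: (addrI (f 0)); have := flin 1 0 0 H0 H0;
    rewrite scaler0 scale1r !addr0 => <-.
have HZ a x : H x -> H (a *: x) by move=> Hx; rewrite -[_ *: x]addr0;
  exact: Hlin.
have fZ a x : H x -> f (a *: x) = a *: f x.
  by move=> Hx; rewrite -[a *: x]addr0 flin// f0 addr0.
have [e e0 fe] : exists2 e : R, 0 < e &
    forall x, H x -> rnorm x < e -> rnorm (f x) < 1.
  have : f @ within H (nbhs 0) --> (0 : W).
    by rewrite -f0; move/subspace_continuousP: fcont; exact.
  move=> /cvgr0_norm_lt /(_ _ ltr01) /nbhs_norm0P [e /= e0 He].
  have eK : of_real k (real_part e) = e by rewrite real_partK// ltW.
  exists (real_part e); first by rewrite -(@ltr_of_real R k) eK of_real0.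
  move=> x Hx xe; rewrite -(@ltr_of_real R k) of_real_rnorm of_real1;
    apply: He => //=.
  by rewrite -of_real_rnorm -eK ltr_of_real.
have ub : has_ubound [set rnorm (f x) | x in [set x | H x /\ rnorm x <= 1]].
  exists (2 / e) => _ [x [Hx x1] <-].
  have := fe _ (HZ (of_real k (e / 2)) _ Hx).
  have e20 : 0 <= e / 2 by rewrite divr_ge0// ltW.
  rewrite fZ// !rnorm_pscale// => h.
  have : e / 2 * rnorm x < e by apply: (@le_lt_trans _ _ (e / 2));
    [rewrite ler_piMr|rewrite ltr_pdivrMr//; lra].
  by move=> /h; rewrite ler_pdivlMr//; lra.
have le1 x : H x -> rnorm x <= 1 -> rnorm (f x) <= opnorm_on H f.
  by move=> Hx x1; apply: ub_le_sup => //; exists x.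
split; first by rewrite -(rnorm0 W) -{1}f0; apply: le1; rewrite // rnorm0.
move=> x Hx; have [->|x0] := eqVneq x 0; first by rewrite f0 !rnorm0 mulr0.
have xp : 0 < rnorm x by rewrite lt_neqAle eq_sym rnorm_eq0 x0 rnorm_ge0.
have := le1 _ (HZ (of_real k (rnorm x)^-1) _ Hx).
rewrite fZ// !rnorm_pscale ?invr_ge0 ?rnorm_ge0// mulVf ?gt_eqF// =>
  /(_ (lexx _)).
by rewrite ler_pdivrMl// mulrC.
Qed.

(** The x_j are combinations of the image b of the unit vector basis of l_oo^m
    under a contraction, and each coordinate has norm at most r in l_2. *)
Definition has_coordinates (X : normedModType K) J (x : 'I_J -> X) (r : R) :=
  exists m (b : 'I_m -> X) (c : 'I_J -> 'I_m -> K),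
    [/\ forall j, x j = \sum_l c j l *: b l,
      forall t : 'I_m -> K, (forall l, rnorm (t l) <= 1) ->
        rnorm (\sum_l t l *: b l) <= 1 &
      forall l, \sum_j rnorm (c j l) ^+ 2 <= r ^+ 2].

Definition weakly_2_bounded (X : normedModType K) J (x : 'I_J -> X) (w : R) :=
  forall phi : dual X, rnorm phi <= 1 -> \sum_j rnorm (phi (x j)) ^+ 2 <= w ^+
    2.

(** Let v be the isomorphism onto l_oo^m and q its inverse, normalised to a
    contraction.  Then the l-th coordinate is the functional |q| v_l on H, whose
    norm is at most |q| |v| < lambda; an extension of it to X can be tested
    against the weak 2-norm of x. *)
Lemma Linfty_coordinates (X : normedModType K) (lambda : R) J
    (x : 'I_J -> X) (w : R) :
  Linfty_space lambda X ->
  weakly_2_bounded x w -> has_coordinates x (lambda * w).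
Proof.
move=> XL xw; have [d [e [efree xe]]] := free_family_spanning x.
have [H [m [[e' [_ HE]] GH [v [q [vlin [vcont qcont] qv vq nrm]]]]]] :=
  XL _ d (ex_intro _ e (conj efree erefl)).
have H0 : H 0.
  by rewrite HE; exists (fun=> 0) => //; rewrite big1// => i _; rewrite scale0r.
have Hlin (a : K) y z : H y -> H z -> H (a *: y + z).
  rewrite HE => -[s _ <-] [t _ <-]; exists (fun i => a * s i + t i) => //.
  rewrite scaler_sumr -big_split; apply: eq_bigr => i _ /=.
  by rewrite scalerDl scalerA.
have Hx j : H (x j) by apply: GH; have [c xc] := xe j; exists c.
have qlin (a : K) y z : q (a *: y + z) = a *: q y + q z.
  have [[Hy vy] [Hz vz]] := (vq y, vq z).
  by rewrite -[RHS]qv ?vlin ?vy ?vz//; exact: Hlin.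
have [nv0 nv] := opnorm_on_ge H0 Hlin vlin vcont.
have [nq0 nq] := @opnorm_on_ge _ _ setT q I (fun _ _ _ _ _ => I)
  (fun a y z _ _ => qlin a y z) (continuous_subspaceT qcont).
rewrite -/(opnorm q) in nq0 nq.
set V := opnorm_on H v in nv0 nv nrm; set Q := opnorm q in nq0 nq nrm.
have l0 : 0 < lambda by apply: le_lt_trans nrm; rewrite mulr_ge0.
have qZ a y : q (a *: y) = a *: q y.
  have q0 : q 0 = 0.
    by apply: (addrI (q 0)); have := qlin 1 0 0;
      rewrite scaler0 scale1r !addr0 => <-.
  by rewrite -[_ *: y]addr0 qlin q0 addr0.
have qsum n (c : 'I_n -> K) (y : 'I_n -> 'rV[K]_m) :
    q (\sum_i c i *: y i) = \sum_i c i *: q (y i).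
  have qD a b : q (a + b) = q a + q b by rewrite -[a]scale1r qlin !scale1r.
  have q0 : q 0 = 0 by rewrite -(scale0r 0) qZ scale0r.
  by rewrite (big_morph q qD q0); apply: eq_bigr => i _; exact: qZ.
(* If q = 0, then H = 0 and there is nothing to normalise. *)
have [Q0|Qn0] := eqVneq Q 0.
  exists 0%N, (fun=> 0), (fun _ _ => 0); split=> [j|t _|[]//].
    rewrite big_ord0; apply/eqP; rewrite -rnorm_eq0 -(qv _ (Hx j)).
    by rewrite eq_le rnorm_ge0 andbT; apply: le_trans (nq _ I) _;
      rewrite Q0 mul0r.
  by rewrite big_ord0 rnorm0.
have Qp : 0 < Q by rewrite lt_neqAle eq_sym Qn0.
exists m, (fun l => of_real k Q^-1 *: q (delta_mx 0 l)).
exists (fun j l => of_real k Q * v (x j) 0 l); split=> [j|t t1|l].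
- rewrite -[LHS](qv _ (Hx j)) {1}[v (x j)]row_sum_delta qsum.
  apply: eq_bigr => l _;
    rewrite scalerA mulrAC -of_realM mulfV// of_real1 mul1r.
  by [].
- under eq_bigr do rewrite scalerA mulrC -scalerA.
  rewrite -scaler_sumr -qsum rnormZ rnorm_real gtr0_norm ?invr_gt0//
    ler_pdivrMl//.
  apply: le_trans (nq _ I) _; rewrite ler_wpM2l//; apply/rnorm_rowP => // l.
  have := t1 l; rewrite summxE (bigD1 l)//= big1 => [|i il].
    by rewrite !mxE !eqxx mulr1 addr0.
  by rewrite !mxE eqxx /= eq_sym (negbTE il) mulr0.
have flin a y z : H y -> H z -> of_real k Q * v (a *: y + z) 0 l =
    a * (of_real k Q * v y 0 l) + of_real k Q * v z 0 l.
  by move=> Hy Hz; rewrite vlin// !mxE; ring.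
have fV y : H y -> rnorm (of_real k Q * v y 0 l) <= lambda * rnorm y.
  move=> Hy; rewrite rnormM rnorm_real ger0_norm//.
  apply: (@le_trans _ _ (Q * (V * rnorm y))).
    rewrite ler_wpM2l//; apply: le_trans (nv _ Hy).
    by have /rnorm_rowP : rnorm (v y) <= rnorm (v y) by []; apply;
      exact: rnorm_ge0.
  by rewrite mulrA ler_wpM2r ?rnorm_ge0// mulrC ltW.
have [g gl gf] := hahn_banach (ltW l0) H0 Hlin flin fV.
have := xw (of_real k lambda^-1 *: g).
rewrite rnormZ rnorm_real gtr0_norm ?invr_gt0// ler_pdivrMl// mulr1 => /(_ gl).
under eq_bigr => j _.
  rewrite (_ : (of_real k lambda^-1 *: g) (x j) = of_real k lambda^-1 * g (x
    j))//.
  rewrite (gf _ (Hx j)) rnormM exprMn rnorm_real real_normK ?num_real//; over.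
by rewrite -mulr_sumr exprVn ler_pdivrMl ?exprn_gt0// exprMn.
Qed.

End coordinates.

(** * Sums of values of a multilinear form *)

Section multilinear_forms.
Variables (R : realType) (k : scalars) (n : nat).
Local Notation K := (base R k).
Variables (E : 'I_n -> completeNormedModType K) (T : (forall i, E i) -> K).
Local Notation tuple := (forall i, E i).
Hypothesis Tlin : forall (x : tuple) (i : 'I_n) (a : K) (u v : E i),
  T (dfwith x i (a *: u + v)) = a * T (dfwith x i u) + T (dfwith x i v).

Lemma dfwith_id (x : tuple) i : dfwith x i (x i) = x.
Proof. by apply: functional_extensionality_dep => j; case: dfwithP. Qed.

Lemma multilinear_sum (x : tuple) i m (c : 'I_m -> K) (b : 'I_m -> E i) :
  T (dfwith x i (\sum_l c l *: b l)) = \sum_l c l * T (dfwith x i (b l)).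
Proof.
pose f u := T (dfwith x i u).
have fD u v : f (u + v) = f u + f v by rewrite /f -[u]scale1r Tlin mul1r
  scale1r.
have f0 : f 0 = 0 by apply: (addrI (f 0)); rewrite -fD !addr0.
rewrite -/(f _) (big_morph f fD f0); apply: eq_bigr => l _.
by rewrite -[_ *: _]addr0 /f Tlin -/(f 0) f0 addr0.
Qed.

Variable M : R.
Hypothesis M0 : 0 <= M.
Hypothesis TM : forall x : tuple, (forall i, rnorm (x i) <= 1) -> rnorm (T x)
  <= M.

Local Notation KG := (grothendieck_constant R k).

(** In coordinates T is a matrix in the two free variables, bounded as a bilinear
    form on l_oo by M.  Multiplying the j-th terms by phases, the sum of the
    moduli becomes the value of this matrix at the vectors of l_2 formed by the
    coordinates, with j as the index of l_2. *)
Lemma bilinear_sum_bound (i0 i1 : 'I_n) J (x : 'I_J -> tuple) (z : tuple)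
    (r s : R) :
  i0 != i1 -> 0 <= r -> 0 <= s ->
  has_coordinates (fun j => x j i0) r -> has_coordinates (fun j => x j i1) s ->
  (forall i, i != i0 -> i != i1 -> rnorm (z i) <= 1 /\ forall j, x j i = z i) ->
  \sum_j rnorm (T (x j)) <= KG * M * (r * s).
Proof.
move=> i01 r0 s0 [m [b [c [xb b1 cr]]]] [m' [b' [c' [xb' b1' cs]]]] xz.
pose Z u v := dfwith (dfwith z i0 u) i1 v.
have xZ j : x j = Z (x j i0) (x j i1).
  apply: functional_extensionality_dep => i; rewrite /Z;
    case: dfwithP => [//|i' ii1].
  case: dfwithP ii1 => [//|i'' ii0 ii1].
  by have [|| _ ->] := xz i''; rewrite 1?eq_sym.
pose a : 'M[K]_(m, m') := \matrix_(l, l') T (Z (b l) (b' l')).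
have Zsum (e : 'I_m -> K) (e' : 'I_m' -> K) :
    T (Z (\sum_l e l *: b l) (\sum_l e' l *: b' l)) =
    \sum_l \sum_l' a l l' * e l * e' l'.
  rewrite /Z multilinear_sum exchange_big; apply: eq_bigr => l' _ /=.
  have swap u v : dfwith (dfwith z i0 u) i1 v = dfwith (dfwith z i1 v) i0 u.
    apply: functional_extensionality_dep => i.
    have [->|ni1] := eqVneq i i1;
      first by rewrite dfwithin dfwithout// dfwithin.
    rewrite dfwithout 1?eq_sym//.
    have [->|ni0] := eqVneq i i0; first by rewrite !dfwithin.
    by rewrite !dfwithout// eq_sym.
  rewrite swap multilinear_sum mulr_sumr; apply: eq_bigr => l _.
  by rewrite mxE /Z swap; ring.
have aM : bilinear_bound a M.
  move=> e e' e1 e1'; rewrite -Zsum; apply: TM => i; rewrite /Z.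
  case: dfwithP => [|i' ii1]; first exact: b1'.
  case: dfwithP ii1 => [_|i'' ii0 ii1]; first exact: b1.
  by have [||] := xz i''; rewrite 1?eq_sym.
have /choice [t tP] : forall j, exists t : K, rnorm t = 1 /\ t * T (x j) =
  of_real k (rnorm (T (x j))).
  by move=> j; have [t t1 tE] := rnorm_phase (T (x j)); exists t.
pose u l j := t j * c j l; pose v l j := conj_base (c' j l).
have -> : \sum_j rnorm (T (x j)) = real_part (sesqui_form a u v).
  rewrite exchange_form -[LHS](of_realK k) of_real_sum; congr real_part.
  apply: eq_bigr => j _; rewrite -(proj2 (tP j)) xZ xb xb' Zsum mulr_sumr.
  apply: eq_bigr => l _; rewrite mulr_sumr; apply: eq_bigr => l' _.
  by rewrite /u /v conj_baseK; ring.
apply: le_trans (real_part_le _) _; apply: grothendieck_form => // l.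
  by under eq_bigr => j _ do rewrite rnormM (proj1 (tP j)) mul1r.
by under eq_bigr => j _ do rewrite rnorm_conj.
Qed.

(** Write T(x_j) = sum_l c_jl A_lj with A_lj = T(x_j with b_l in place i0).  By
    the Cauchy-Schwarz inequality the sum over j is at most r times the sum
    over l of the l_2 norms of A_l; by Khintchine's inequality the latter is at
    most sqrt 3 times a mean over signs e of sum_l |sum_j e_j A_lj|.  For fixed
    signs this is sum_j e_j T(x_j with u in place i0), where u = sum_l t_l b_l
    with phases t_l is a vector of the unit ball. *)
Lemma coordinate_step (i0 : 'I_n) J (x : 'I_J -> tuple) (r B : R) :
  0 <= r -> has_coordinates (fun j => x j i0) r ->
  (forall u : E i0, rnorm u <= 1 -> \sum_j rnorm (T (dfwith (x j) i0 u)) <= B)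
    ->
  \sum_j rnorm (T (x j)) <= Num.sqrt 3 * B * r.
Proof.
move=> r0 [m [b [c [xb b1 cr]]]] IH.
pose A l j := T (dfwith (x j) i0 (b l)).
have [N [e eE]] := rademacher_family_exists R k J.
have N0 : 0 < N%:R :> R by have [] := eE; rewrite ltr0n.
have TE j : T (x j) = \sum_l c j l * A l j.
  by rewrite -[x j](dfwith_id _ i0) xb multilinear_sum.
have signs w : \sum_l rnorm (signed_sum (e w) (A l)) <= B.
  have /choice [t tP] : forall l, exists t : K, rnorm t = 1 /\
      t * signed_sum (e w) (A l) = of_real k (rnorm (signed_sum (e w) (A l))).
    by move=> l; have [t t1 tE] := rnorm_phase (signed_sum (e w) (A l));
      exists t.
  have t1 : rnorm (\sum_l t l *: b l) <= 1.
    by apply: b1 => l; rewrite (proj1 (tP l)).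
  apply: le_trans (IH _ t1).
  rewrite -[leLHS](of_realK k) of_real_sum.
  under eq_bigr do rewrite -(proj2 (tP _)) mulr_sumr.
  rewrite exchange_big real_part_sum; apply: ler_sum => j _.
  apply: le_trans (real_part_le _) _.
  rewrite multilinear_sum (eq_bigr (fun l => (-1) ^+ e w j * (t l * A l j))).
    by rewrite -mulr_sumr rnormM; case: (e w j);
      rewrite ?expr1 ?rnormN rnorm1 mul1r.
  by move=> l _; rewrite mulrCA.
have sqrt_le : \sum_l Num.sqrt (\sum_j rnorm (A l j) ^+ 2) <= Num.sqrt 3 * B.
  rewrite -(ler_pM2l N0) mulr_sumr.
  apply: le_trans (ler_sum _ (fun l _ => khintchine (A l) eE)) _.
  rewrite -mulr_sumr exchange_big /= [leRHS]mulrCA ler_wpM2l ?sqrtr_ge0//.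
  apply: le_trans (ler_sum _ (fun w _ => signs w)) _.
  by rewrite sumr_const card_ord -[leLHS]mulr_natl.
apply: (@le_trans _ _ (\sum_l Num.sqrt (\sum_j rnorm (A l j) ^+ 2) * r));
  last first.
  by rewrite -mulr_suml ler_wpM2r.
under eq_bigr do rewrite TE.
apply: le_trans (ler_sum _ (fun j _ => rnorm_sum _ _ _)) _.
rewrite exchange_big; apply: ler_sum => l _ /=.
under eq_bigr do rewrite rnormM mulrC.
by apply: cauchy_schwarz_sum => // j; exact: rnorm_ge0.
Qed.

(** Grothendieck's inequality for two variables, then one coordinate at a time. *)
Lemma multilinear_sum_bound (p : nat) J (x : 'I_J -> tuple) (z : tuple)
    (r : 'I_n -> R) :
  (2 <= p <= n)%N ->
  (forall i : 'I_n, (i < p)%N ->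
     0 <= r i /\ has_coordinates (fun j => x j i) (r i)) ->
  (forall i : 'I_n, (p <= i)%N -> rnorm (z i) <= 1 /\ forall j, x j i = z i) ->
  \sum_j rnorm (T (x j)) <=
    KG * Num.sqrt 3 ^+ (p - 2) * M * \prod_(i < n | (i < p)%N) r i.
Proof.
case: p => [|[|p]]//; elim: p x z => [|p IH] x z /andP[_ pn] xr xz.
  have n0 : (0 < n)%N by exact: ltn_trans pn.
  pose i0 := Ordinal n0; pose i1 := Ordinal pn.
  have [r0 c0] := xr i0 isT; have [r1 c1] := xr i1 isT.
  rewrite subnn expr0 mulr1 (bigD1 i0)//= (bigD1 i1)//= [X in r i1 * X]big1
    ?mulr1; last first.
    by move=> [[|[|i]] ilt].
  apply: (bilinear_sum_bound (i0 := i0) (i1 := i1) (z := z)) => // i ni0 ni1;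
    apply: xz.
  by case: i ni0 ni1 => [[|[|i]]] ilt.
pose i0 := Ordinal pn; have [r0 c0] := xr i0 (leqnn _).
rewrite (bigD1 i0)//= (eq_bigl (fun i : 'I_n => (i < p.+2)%N)); last first.
  move=> i; rewrite ltnS leq_eqVlt -[i == i0]/(i == p.+2 :> nat).
  by case: ltngtP; rewrite ?andbF.
set P := \prod_(_ < _ | _) _.
have -> : KG * Num.sqrt 3 ^+ (p.+3 - 2) * M * (r i0 * P) =
    Num.sqrt 3 * (KG * Num.sqrt 3 ^+ (p.+2 - 2) * M * P) * r i0.
  by rewrite subSn// exprS; ring.
apply: (coordinate_step (i0 := i0)) => // u u1.
apply: (IH (fun j => dfwith (x j) i0 u) (dfwith z i0 u)).
- by rewrite /= ltnW.
- move=> i ip; have ni0 : i0 != i by rewrite -[i0 == i]/(p.+2 == i :> nat)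
  gtn_eqF.
  have [ri ci] := xr i (ltnW ip); split=> //.
  rewrite (_ : (fun j => _) = (fun j => x j i))//.
  by apply/funext => j; rewrite dfwithout.
- move=> i pi; have [i0i|ni0] := eqVneq i0 i.
    by subst i; rewrite dfwithin; split=> // j; rewrite dfwithin.
  have [|zi xzi] := xz i; first by rewrite ltn_neqAle pi andbT.
  by rewrite dfwithout//; split=> // j; rewrite dfwithout.
Qed.

End multilinear_forms.

(** * Boundedness of continuous multilinear forms *)

Section bounded.
Variables (R : realType) (k : scalars) (n : nat).
Local Notation K := (base R k).
Variables (E : 'I_n -> completeNormedModType K) (T : (forall i, E i) -> K).
Local Notation tuple := (forall i, E i).
Hypothesis Tlin : forall (x : tuple) (i : 'I_n) (a : K) (u v : E i),
  T (dfwith x i (a *: u + v)) = a * T (dfwith x i u) + T (dfwith x i v).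

Lemma multilinearZ1 (x : tuple) i (a : K) :
  T (dfwith x i (a *: x i)) = a * T x.
Proof.
have := @multilinear_sum R k n E T Tlin x i 1 (fun=> a) (fun=> x i).
by rewrite !big_ord1 dfwith_id.
Qed.

Lemma multilinearZ (x : tuple) (a : K) : T (fun i => a *: x i) = a ^+ n * T x.
Proof.
pose y p : tuple := fun i => if (i < p)%N then a *: x i else x i.
suff h p : (p <= n)%N -> T (y p) = a ^+ p * T x.
  rewrite -(h n)//; congr T; apply: functional_extensionality_dep => i.
  by rewrite /y ltn_ord.
elim: p => [|p IH] pn.
  by rewrite expr0 mul1r; congr T; apply: functional_extensionality_dep => i.
rewrite exprS -mulrA -IH 1?ltnW// -(multilinearZ1 _ (Ordinal pn)); congr T.
apply: functional_extensionality_dep => i; rewrite /y; case: dfwithP => /= [|j].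
  by rewrite ltnS leqnn ltnn.
by rewrite ltnS leq_eqVlt -val_eqE /= eq_sym => /negbTE ->.
Qed.

Lemma cvg_prod (u : nat -> tuple) :
  (forall i, (fun N => u N i) @ \oo --> (0 : E i)) ->
  u @ \oo --> ((fun i => 0) : prod_topology (fun i => E i)).
Proof.
move=> ucvg; apply/cvg_sup => i.
have surj : @proj _ (fun i => E i) i @` setT = setT.
  by rewrite eqEsubset; split=> // y _;
    exists (dfwith (fun i => 0 : E i) i y) => //; rewrite /proj dfwithin.
apply/cvg_image => // A nA; exists (proj i @^-1` A);
  last by rewrite image_preimage.
exact: ucvg.
Qed.

Hypothesis Tcont : continuous (T : prod_topology (fun i => E i) -> K).

(** If |T(z_N)| > (N + 1)^n (|T(0)| + 1) with z_N in the unit balls, then the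
    tuples z_N / (N + 1) tend to 0, but T stays away from T(0) on them. *)
Lemma multilinear_ubound :
  has_ubound
    [set rnorm (T x) | x in [set x : tuple | forall i, rnorm (x i) <= 1]].
Proof.
apply: contrapT => nub.
set t0 : R := rnorm (T (fun i => 0)) + 1.
have /choice [z zP] : forall N : nat, exists z : tuple,
    (forall i, rnorm (z i) <= 1) /\ N.+1%:R ^+ n * t0 < rnorm (T z).
  move=> N; apply: contrapT => h; apply: nub; exists (N.+1%:R ^+ n * t0).
  move=> _ [z z1 <-]; rewrite leNgt; apply/negP => lt; apply: h; exists z;
    split=> //.
pose u N : tuple := fun i => of_real k N.+1%:R^-1 *: z N i.
have ucvg : u @ \oo --> ((fun i => 0) : prod_topology (fun i => E i)).
  apply: cvg_prod => i; apply/cvgr0Pnorm_lt => e e0.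
  have e0' : 0 < real_part e.
    by rewrite -(@ltr_of_real R k) of_real0 real_partK// ltW.
  apply: filterS (near_infty_natSinv_lt (PosNum e0')) => N /= Ne.
  rewrite -(real_partK (ltW e0)) -of_real_rnorm ltr_of_real.
  rewrite /u rnormZ rnorm_real ger0_norm ?invr_ge0//.
  by apply: le_lt_trans Ne; rewrite ler_piMr ?invr_ge0//; exact: (proj1 (zP N)).
have uT : T (u N) @[N --> \oo] --> T (fun i => 0).
  exact: (cvg_comp _ _ ucvg (@Tcont (fun i => 0 : E i))).
have uT1 : \forall N \near \oo, `|T (fun i => 0) - T (u N)| < 1.
  by move: uT; move=> /cvgrPdist_lt /(_ 1 ltr01).
have [N0 _ /(_ N0 (leqnn _)) /=] := uT1.
rewrite -of_real_rnorm -(of_real1 R k) ltr_of_real => lt1.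
have [_] := zP N0; rewrite ltNge => /negP; apply.
have -> : T (z N0) = of_real k (N0.+1%:R ^+ n) * T (u N0).
  rewrite /u multilinearZ mulrA.
  have -> m : of_real k N0.+1%:R^-1 ^+ m = of_real k (N0.+1%:R^-1 ^+ m).
    by elim: m => [|m IH]; rewrite ?of_real1// !exprS of_realM IH.
  by rewrite -of_realM -exprMn mulfV// expr1n of_real1 mul1r.
rewrite rnormM rnorm_real ger0_norm ?exprn_ge0// ler_wpM2l ?exprn_ge0//.
rewrite -[T (u N0)](subrK (T (fun i => 0))).
apply: le_trans (rnormD _ _) _; rewrite addrC lerD2l.
by rewrite -rnormN opprB ltW.
Qed.

Lemma mnorm_ge (x : tuple) : (forall i, rnorm (x i) <= 1) ->
  rnorm (T x) <= mnorm T.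
Proof. by move=> x1; apply: (ub_le_sup multilinear_ubound); exists x. Qed.

Lemma mnorm_ge0 : 0 <= mnorm T.
Proof.
apply: le_trans (rnorm_ge0 _) (@mnorm_ge (fun i => 0) _) => i.
by rewrite rnorm0.
Qed.

End bounded.

(** * Integrals, series and weak norms *)

Section series_norms.
Variables (R : realType) (k : scalars).
Local Notation K := (base R k).

(** The integral of a nonnegative function is the supremum of the integrals of
    the simple functions below it, and so it is monotone in the function. *)
Lemma integral_le (f : R -> R) (b : R) : 0 <= b ->
  (forall t, 0 <= f t <= b) ->
  \int[lebesgue_measure]_(t in `[0, 1]) f t <= b.
Proof.
move=> b0 fb; set I := (\int[lebesgue_measure]_(t in `[0%R, 1%R]) (f t)%:E)%E.
have I0 : (0 <= I)%E.
  by apply: integral_ge0 => t _; rewrite lee_fin; have /andP[] := fb t.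
have Ib : (I <= b%:E)%E.
  have -> : b%:E = (\int[lebesgue_measure]_(t in `[0%R, 1%R]) b%:E)%E.
    rewrite integral_cst//= lebesgue_measure_itv /= lte_fin ltr01.
    by rewrite sube0 mule1.
  rewrite /I !ge0_integralE => [|t _|t _]; last 2 first.
  - by rewrite lee_fin.
  - by rewrite lee_fin; have /andP[] := fb t.
  apply: le_ereal_sup => _ [h hf <-]; exists h => // t;
    apply: le_trans (hf t) _.
  rewrite /patch; case: ifP => // _.
  by rewrite lee_fin; have /andP[] := fb t.
rewrite /Rintegral -/I -lee_fin fineK// fin_numElt.
by rewrite (lt_le_trans _ I0)// (le_lt_trans Ib)// ltry.
Qed.

Lemma partial_sum_EFin (V : normedModType K) (y : nat -> V) J :
  (\sum_(0 <= j < J) (rnorm (y j) `^ 2)%:E)%E =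
  (\sum_(j < J) rnorm (y j) ^+ 2)%:E.
Proof.
rewrite big_mkord -sumEFin; apply: eq_bigr => j _.
by rewrite powR_mulrn ?rnorm_ge0.
Qed.

Lemma psum_le (V : normedModType K) (y : nat -> V) (C : R) :
  (forall J, \sum_(j < J) rnorm (y j) ^+ 2 <= C) -> (psum 2 y <= C%:E)%E.
Proof.
move=> yC; apply: lime_le.
  by apply: is_cvg_ereal_nneg_natsum => j _; rewrite lee_fin powR_ge0.
by apply: nearW => J; rewrite partial_sum_EFin lee_fin.
Qed.

Lemma weak_norm2P (V : normedModType K) (x : nat -> V) :
  (weak_norm 2%:E x < +oo)%E ->
  0 <= fine (weak_norm 2%:E x) /\
  forall J, weakly_2_bounded (fun j : 'I_J => x j) (fine (weak_norm 2%:E x)).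
Proof.
rewrite /=; set w := ereal_sup _ => woo.
have le_w (phi : dual V) J : rnorm phi <= 1 ->
    ((Num.sqrt (\sum_(j < J) rnorm (phi (x j)) ^+ 2))%:E <= w)%E.
  move=> phi1.
  set S := (\sum_(0 <= j <oo) (rnorm (phi (x j)) `^ 2)%:E)%E.
  apply: (@le_trans _ _ (S `^ 2^-1)%E); last by apply: ereal_sup_ubound;
    exists phi.
  rewrite -powR12_sqrt ?sumr_ge0// -?poweR_EFin; last by move=> *;
    exact: sqr_ge0.
  have S0 : (0 <= S)%E by apply: nneseries_ge0 => j _ _;
    rewrite lee_fin powR_ge0.
  apply: gt0_ler_poweR.
  - by rewrite invr_ge0.
  - by rewrite in_itv /= leey lee_fin sumr_ge0// => j _; exact: sqr_ge0.
  - by rewrite in_itv /= leey S0.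
  rewrite -[X in (X <= _)%E](partial_sum_EFin (V := K^o) (fun j => phi (x j))).
  by apply: nneseries_lim_ge => j _ _; rewrite lee_fin powR_ge0.
have w0 : (0 <= w)%E.
  have := le_w 0 0%N; rewrite big_ord0 sqrtr0; apply; by rewrite rnorm0.
have wfin : w \is a fin_num.
  by rewrite fin_numElt woo (lt_le_trans _ w0).
split=> [|J phi phi1]; first exact: fine_ge0.
have s0 : 0 <= \sum_(j < J) rnorm (phi (x j)) ^+ 2.
  by apply: sumr_ge0 => j _; exact: sqr_ge0.
rewrite -[leLHS]sqr_sqrtr// ler_sqr ?nnegrE ?sqrtr_ge0 ?fine_ge0//.
by rewrite -lee_fin fineK//; exact: le_w.
Qed.

Lemma weak_normooP (V : normedModType K) (x : nat -> V) :
  (weak_norm +oo x < +oo)%E -> forall j, rnorm (x j) <= fine (weak_norm +oo x).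
Proof.
rewrite /=; set w := ereal_sup _ => woo j.
have le_w : ((rnorm (x j))%:E <= w)%E by apply: ereal_sup_ubound; exists j.
rewrite -lee_fin fineK// fin_numElt woo andbT (lt_le_trans _ le_w)//.
exact: ltNyr.
Qed.

End series_norms.

(** * Summability at the origin *)

Section summing.
Variables (R : realType) (k : scalars) (n : nat) (n_ge2 : (2 <= n)%N).
Variables (lambda : 'I_n -> R) (X : 'I_n -> completeNormedModType (base R k)).
Hypothesis lambda_gt1 : forall j, 1 < lambda j.
Hypothesis X_Linfty : forall j, Linfty_space (lambda j) (X j).
Variable T : (forall j, X j) -> base R k.
Hypothesis T_cont : continuous_multilinear T.

Local Notation q := (exponents R n_ge2).
Local Notation last := (last_index n_ge2).
Local Notation KG := (grothendieck_constant R k).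
Local Notation M := (mnorm T).

Let Tlin (x : forall i, X i) (i : 'I_n) (a : base R k) (u v : X i) :
  T (dfwith x i (a *: u + v)) = a * T (dfwith x i u) + T (dfwith x i v).
Proof. by case: T_cont => Tmul _; exact: Tmul. Qed.

Let Tc : continuous (T : prod_topology (fun i => X i) -> base R k).
Proof. by case: T_cont. Qed.

Let M0 : 0 <= M. Proof. exact: mnorm_ge0. Qed.

Let TM (x : forall i, X i) : (forall i, rnorm (x i) <= 1) -> rnorm (T x) <= M.
Proof. exact: mnorm_ge. Qed.

Let KG0 : 0 <= KG. Proof. exact: grothendieck_constant_ge0. Qed.

Let lambda0 i : 0 <= lambda i.
Proof. exact: ltW (lt_trans ltr01 (lambda_gt1 i)). Qed.

Let n_pred : n = n.-1.+1. Proof. by rewrite prednK// ltnW. Qed.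

Let neq_last (i : 'I_n) : (i < n.-1)%N -> i != last.
Proof. by move=> ip; rewrite -val_eqE /= ltn_eqF. Qed.

Let eq_last (i : 'I_n) : (n.-1 <= i)%N -> i = last.
Proof.
move=> ip; apply/val_inj/eqP => /=.
by rewrite eqn_leq ip andbT -ltnS -n_pred ltn_ord.
Qed.

Section sequences.
Variable x : forall i, nat -> X i.
Hypothesis xoo : forall i, (weak_norm (q i) (x i) < +oo)%E.

Local Notation w := (fun i => fine (weak_norm (q i) (x i))).
Local Notation terms := (fun j i => x i j).

Let weak2 i J : i != last -> weakly_2_bounded (fun j : 'I_J => x i j) (w i).
Proof.
move=> /negbTE il; have := xoo i.
by rewrite /exponents il => /weak_norm2P[_]; exact.
Qed.

Let weakoo j : rnorm (x last j) <= w last.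
Proof. by have := xoo last; rewrite /exponents eqxx => /weak_normooP; exact.
Qed.

Let w_ge0 i : 0 <= w i.
Proof.
have [->|il] := eqVneq i last; first exact: le_trans (rnorm_ge0 _) (weakoo 0).
by have := xoo i; rewrite /exponents (negbTE il) => /weak_norm2P[].
Qed.

Let lw_ge0 i : 0 <= lambda i * w i. Proof. exact: mulr_ge0. Qed.

Lemma weighted_weakly_2_bounded J (beta : 'I_J -> R) :
  (forall j, 0 <= beta j) ->
  weakly_2_bounded (fun j => of_real k (beta j) *: x last j)
    (w last * Num.sqrt (\sum_j beta j ^+ 2)).
Proof.
move=> beta0 phi phi1.
have s0 : 0 <= \sum_j beta j ^+ 2 by apply: sumr_ge0 => j _; exact: sqr_ge0.
rewrite exprMn sqr_sqrtr// mulr_sumr; apply: ler_sum => j _.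
rewrite -exprMn ler_sqr ?nnegrE ?rnorm_ge0 ?mulr_ge0 ?beta0 ?w_ge0//.
apply: le_trans (scalar_ball_bound (dual_linear phi) (c := 1) _ _) _.
  by move=> u u1; apply: le_trans (dual_opnorm_ge phi u1) _;
    rewrite -rnorm_dual.
by rewrite mul1r rnorm_pscale// mulrC ler_wpM2r.
Qed.

(** The weights beta_j = |T(x_j)| on the last variable make the sum of the moduli
    equal to the sum S of the squares, while they multiply the bound C by
    sqrt S: from S <= C sqrt S follows S <= C^2. *)
Lemma sum_sqr_bound J :
  \sum_(j < J) rnorm (T (terms j)) ^+ 2 <=
    (KG * Num.sqrt 3 ^+ (n - 2) * M * \prod_(i < n) (lambda i * w i)) ^+ 2.
Proof.
set C := KG * _ * M * _.
pose beta (j : 'I_J) := rnorm (T (terms j)).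
set S := \sum_j _; have SE : S = \sum_j beta j ^+ 2 by [].
have S0 : 0 <= S by apply: sumr_ge0 => j _; exact: sqr_ge0.
pose y (j : 'I_J) := dfwith (terms j) last (of_real k (beta j) *: x last j).
pose r i := lambda i * (if i == last then w i * Num.sqrt S else w i).
have sumy : S = \sum_j rnorm (T (y j)).
  apply: eq_bigr => j _; rewrite /y (multilinearZ1 Tlin (terms j)).
  by rewrite rnormM rnorm_real ger0_norm ?rnorm_ge0.
have yr i : 0 <= r i /\ has_coordinates (fun j => y j i) (r i).
  rewrite /r; have [->|il] := eqVneq i last.
    split; first by rewrite !mulr_ge0 ?sqrtr_ge0 ?w_ge0.
    apply: Linfty_coordinates => //; rewrite SE.
    rewrite (_ : (fun j => y j last) = fun j => of_real k (beta j) *: x last j).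
      by apply: weighted_weakly_2_bounded => j; exact: rnorm_ge0.
    by apply/funext => j; rewrite /y dfwithin.
  split; first exact: lw_ge0.
  apply: Linfty_coordinates => //.
  rewrite (_ : (fun j => y j i) = fun j : 'I_J => x i j); first exact: weak2.
  by apply/funext => j; rewrite /y dfwithout// eq_sym.
have bnd : S <= C * Num.sqrt S.
  rewrite {1}sumy.
  have := multilinear_sum_bound Tlin M0 TM (p := n) (x := y)
    (z := fun i => 0) (r := r).
  rewrite n_ge2 leqnn => /(_ isT (fun i _ => yr i)) h.
  apply: le_trans (h _) _; first by move=> i; rewrite leqNgt ltn_ord.
  rewrite (eq_bigl xpredT) => [|i]; last exact: ltn_ord.
  rewrite /C (bigD1 last)//= [in leRHS](bigD1 last)//= {1}/r eqxx.
  rewrite (eq_bigr (fun i => lambda i * w i)) => [|i /negbTE il].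
    by rewrite le_eqVlt; apply/orP; left; apply/eqP; ring.
  by rewrite /r il.
have C0 : 0 <= C.
  rewrite /C !mulr_ge0 ?exprn_ge0 ?sqrtr_ge0 ?KG0 ?M0//.
  by apply: prodr_ge0 => i _; exact: lw_ge0.
rewrite -[leLHS]sqr_sqrtr// ler_sqr ?nnegrE ?sqrtr_ge0//.
have [->//|Sn0] := eqVneq (Num.sqrt S) 0.
have Sp : 0 < Num.sqrt S by rewrite lt_neqAle eq_sym Sn0 sqrtr_ge0.
by rewrite -(ler_pM2r Sp) -expr2 sqr_sqrtr.
Qed.

(** Freezing the last variable leaves n - 1 coordinates: the exponent of sqrt 3
    drops by one. *)
Definition slices_bound : R :=
  KG * Num.sqrt 3 ^+ (n - 3) * M *
  \prod_(i < n | (i < n.-1)%N) (lambda i * w i).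

Hypothesis n_ge3 : (3 <= n)%N.

Let slices_bound_ge0 : 0 <= slices_bound.
Proof.
rewrite /slices_bound !mulr_ge0 ?exprn_ge0 ?sqrtr_ge0 ?KG0 ?M0//.
by apply: prodr_ge0 => i _; exact: lw_ge0.
Qed.

Lemma sum_slices_le J (u : X last) : rnorm u <= 1 ->
  \sum_(j < J) rnorm (T (dfwith (terms j) last u)) <= slices_bound.
Proof.
move=> u1; have := multilinear_sum_bound Tlin M0 TM (p := n.-1)
  (x := fun j : 'I_J => dfwith (terms j) last u)
  (z := dfwith (fun i => 0 : X i) last u) (r := fun i => lambda i * w i).
rewrite /slices_bound (_ : (n.-1 - 2 = n - 3)%N);
  last by rewrite -subn1 -subnDA.
apply.
- by rewrite leq_pred andbT -ltnS -n_pred.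
- move=> i /neq_last il; split; first exact: lw_ge0.
  apply: Linfty_coordinates => //.
  rewrite (_ : (fun j => _) = fun j : 'I_J => x i j); first exact: weak2.
  by apply/funext => j; rewrite dfwithout// eq_sym.
- by move=> i /eq_last ->; rewrite dfwithin; split=> // j; rewrite dfwithin.
Qed.

Let slice_linear j : scalar (fun u => T (dfwith (terms j) last u)).
Proof. by move=> a u v; exact: Tlin. Qed.

Let slice_le j u :
  rnorm (T (dfwith (terms j) last u)) <= slices_bound * rnorm u.
Proof.
apply: (scalar_ball_bound (@slice_linear j)) => v v1.
apply: le_trans (sum_slices_le j.+1 v1).
by rewrite (bigD1 ord_max)//= lerDl sumr_ge0// => i _; exact: rnorm_ge0.
Qed.

(** The functional T(x_j^1, .., x_j^(n-1), -), an element of the dual of the last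
    space. *)
Definition slice j : dual (X last) :=
  Dual (dual_mem (slice_linear j) (slice_le j)).

(** The bound on sum_j |T(x_j^1, .., x_j^(n-1), u)| holds for every u in the unit
    ball, so it bounds the norm of sum_j r_j(t) slice_j for every t, the
    Rademacher functions being bounded by 1. *)
Lemma cotype_slices (C2 : R) J : cotype2_constant (dual (X last)) C2 ->
  \sum_(j < J) rnorm (slice j) ^+ 2 <= (C2 * slices_bound) ^+ 2.
Proof.
move=> [C20 /(_ J (fun j => slice j))].
set I := (X in C2 * Num.sqrt X) => cot.
have IB : I <= slices_bound ^+ 2.
  apply: integral_le => [|t]; first exact: sqr_ge0.
  rewrite sqr_ge0 /= ler_sqr ?nnegrE ?rnorm_ge0 ?slices_bound_ge0// rnorm_dual.
  apply: dual_opnorm_le => u u1.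
  pose eval (g : dual (X last)) := g u.
  have evalD g h : eval (g + h) = eval g + eval h by [].
  rewrite -/(eval _) (big_morph eval evalD (erefl : eval 0 = 0)).
  apply: le_trans (rnorm_sum _ _ _) _; apply: le_trans (sum_slices_le J u1).
  apply: ler_sum => j _.
  rewrite (_ : eval _ = of_real k (rademacher j t) * slice j u)// rnormM.
  rewrite rnorm_real ler_piMl ?rnorm_ge0// normr_sg.
  by case: (_ != _).
have s0 : 0 <= \sum_(j < J) rnorm (slice j) ^+ 2.
  by apply: sumr_ge0 => j _; exact: sqr_ge0.
have CB0 := mulr_ge0 C20 slices_bound_ge0.
rewrite -[leLHS]sqr_sqrtr// ler_sqr ?nnegrE ?sqrtr_ge0//.
apply: le_trans cot _; rewrite ler_wpM2l//.
by rewrite -[leRHS](ger0_norm slices_bound_ge0) -sqrtr_sqr ler_wsqrtr.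
Qed.

Lemma psum_cotype_bound (C2 : R) : cotype2_constant (dual (X last)) C2 ->
  (psum 2 (fun j => T (terms j)) `^ 2^-1 <=
    (C2 * slices_bound * w last)%:E)%E.
Proof.
move=> cot; have C20 : 0 <= C2 by case: cot.
have Tslice j : rnorm (T (terms j)) <= rnorm (slice j) * w last.
  have -> : T (terms j) = slice j (x last j) by rewrite /= (dfwith_id (terms
    j)).
  apply: (@le_trans _ _ (rnorm (slice j) * rnorm (x last j))).
    apply: (scalar_ball_bound (dual_linear (slice j))) => u u1.
    by rewrite rnorm_dual; exact: dual_opnorm_ge.
  by rewrite ler_wpM2l ?rnorm_ge0 ?weakoo.
set B := C2 * slices_bound * w last.
have B0 : 0 <= B := mulr_ge0 (mulr_ge0 C20 slices_bound_ge0) (w_ge0 last).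
have psumB : (psum 2 (fun j => T (terms j)) <= (B ^+ 2)%:E)%E.
  apply: psum_le => J; rewrite [leRHS]exprMn.
  apply: le_trans (ler_wpM2r (sqr_ge0 _) (cotype_slices J cot)).
  rewrite mulr_suml; apply: ler_sum => j _.
  rewrite -exprMn ler_sqr ?nnegrE ?mulr_ge0 ?rnorm_ge0 ?w_ge0//; exact: Tslice.
have psum0 : (0 <= psum 2 (fun j => T (terms j)))%E.
  by apply: nneseries_ge0 => j _ _; rewrite lee_fin powR_ge0.
apply: (@le_trans _ _ ((B ^+ 2)%:E `^ 2^-1)%E).
  apply: gt0_ler_poweR => //; rewrite ?invr_ge0// in_itv /= leey ?andbT//.
  by rewrite lee_fin sqr_ge0.
by rewrite poweR_EFin lee_fin powR12_sqrt ?sqr_ge0// sqrtr_sqr ger0_norm.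
Qed.

(** The two sides differ by the factor lambda > 1 of the last space. *)
Lemma slices_bound_le (C2 : R) : 0 <= C2 ->
  C2 * slices_bound * w last <=
  C2 * KG * 3 `^ ((n%:R - 3) / 2) * M * \prod_(j < n) lambda j *
    \prod_(i < n) w i.
Proof.
move=> C20.
have -> : 3 `^ ((n%:R - 3) / 2) = Num.sqrt 3 ^+ (n - 3) :> R.
  by rewrite -natrB// mulrC powRrM powR12_sqrt// powR_mulrn ?sqrtr_ge0.
have split_last (h : 'I_n -> R) :
    \prod_i h i = h last * \prod_(i < n | (i < n.-1)%N) h i.
  rewrite (bigD1 last)//=; congr (_ * _); apply: eq_bigl => i.
  apply/idP/idP => [il|/neq_last//]; rewrite ltnNge; apply/negP => /eq_last il'.
  by rewrite il' eqxx in il.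
rewrite !split_last /slices_bound big_split /=.
set Pl := \prod_(i < n | _) lambda i; set Pw := \prod_(i < n | _) w i.
have Pl0 : 0 <= Pl by apply: prodr_ge0.
have Pw0 : 0 <= Pw by apply: prodr_ge0 => i _; exact: w_ge0.
pose D := C2 * KG * Num.sqrt 3 ^+ (n - 3) * M * Pl * Pw * w last.
have D0 : 0 <= D.
  by rewrite /D !mulr_ge0 ?exprn_ge0 ?sqrtr_ge0 ?KG0 ?M0 ?w_ge0.
rewrite [leLHS](_ : _ = D); last by rewrite /D; ring.
rewrite [leRHS](_ : _ = lambda last * D); last by rewrite /D; ring.
by rewrite ler_peMl// ltW.
Qed.

Lemma prod_weak_norm_ge0 : 0 <= \prod_(i < n) w i.
Proof. by apply: prodr_ge0 => i _; exact: w_ge0. Qed.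

End sequences.
End summing.

Theorem theorem8 (R : realType) (k : scalars) (n : nat) (n_ge2 : (2 <= n)%N)
  (lambda : 'I_n -> R) (X : 'I_n -> completeNormedModType (base R k))
  (lambda_gt1 : forall j, 1 < lambda j)
  (X_Linfty : forall j, Linfty_space (lambda j) (X j))
  (T : (forall j, X j) -> base R k) (T_cont : continuous_multilinear T) :
  summing_at_origin 2 (exponents R n_ge2) T /\
  ((3 <= n)%N -> forall C2 : R, cotype2_constant (dual (X (last_index n_ge2))) C2 ->
    (as_norm 2 (exponents R n_ge2) T <=
      (C2 * grothendieck_constant R k * 3 `^ ((n%:R - 3) / 2) * mnorm T *
        \prod_(j < n) lambda j)%:E)%E).
Proof.
split=> [x xoo|n_ge3 C2 cot].
  apply: le_lt_trans (psum_le _) (ltry _) => J.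
  exact: (sum_sqr_bound lambda_gt1 X_Linfty T_cont xoo).
have C20 : 0 <= C2 by case: cot.
have [Tmul Tc] := T_cont.
apply/lee_addgt0Pr => eps eps0; apply: ereal_inf_lbound; eexists; last by [].
split=> [|x xoo].
  rewrite ltr_wpDl// !mulr_ge0 ?powR_ge0 ?grothendieck_constant_ge0//.
    exact: mnorm_ge0.
  by apply: prodr_ge0 => i _; rewrite ltW// (lt_trans ltr01).
apply: le_trans (psum_cotype_bound lambda_gt1 X_Linfty T_cont xoo n_ge3 cot) _.
rewrite lee_fin mulrDl.
apply: le_trans (slices_bound_le lambda_gt1 T_cont xoo n_ge3 C20) _.
by rewrite lerDl mulr_ge0 ?(ltW eps0)// prod_weak_norm_ge0.
Qed.
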